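(* Let $X$ be a large-scale simply connected graph whose group of isometries $\mathrm{Isom}(X)$ is cocompact (for example, $X$ vertex-transitive). Then $X$ is USLG-rigid if and only if the vertex-stabilizers of $\mathrm{Isom}(X)$ are finite.
   Context: A ''graph'' means a connected, locally finite graph without loops or multiple edges, equipped with the geodesic metric giving each edge length $1$; ''$x\in X$'' means that $x$ is a vertex of $X$; balls are closed balls. $\mathrm{Isom}(X)$ is cocompact if it has finitely many orbits of vertices. A covering from a graph $X$ to a graph $Y$ is a graph covering map (a surjective graph morphism which, for every vertex $x$, maps the neighbors of $x$ bijectively onto the neighbors of its image). For a graph $X$ and $k\in\mathbf{N}$, $P_k(X)$ is the 2-dimensional CW-complex whose 1-skeleton is $X$ and whose 2-cells are $m$-gons, $0\le m\le k$, one attached along each simple loop $(x_0,\dots,x_m=x_0)$ of length $m$ in $X$ (up to cyclic permutations). $X$ is $k$-simply connected if $P_k(X)$ is simply connected, and large-scale simply connected if it is $k$-simply connected for some $k$. Given a graph $X$ and $R>0$, a graph $Y$ is $R$-locally $X$ if for every vertex $y\in Y$ there exists $x\in X$ such that the balls $B_X(x,R)$ and $B_Y(y,R)$, equipped with their intrinsic geodesic metrics, are isometric. For $0<r\le R$, $X$ is USLG-rigid at scales $(r,R)$ if for every graph $Y$ which is $R$-locally $X$ and every isometry $f$ from a ball $B(x,R)$ in $X$ to a ball $B(y,R)$ in $Y$, the restriction of $f$ to $B(x,r)$ extends to a covering from $X$ to $Y$, and this covering is unique. $X$ is USLG-rigid if for all large enough $r$ there exists $R$ such that $X$ is USLG-rigid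 at scales $(r,R)$. *)

(* Defs.v *)
From HB Require Import structures.
From mathcomp Require Import all_boot all_order all_algebra generic_quotient.
From mathcomp Require Import all_classical all_reals all_analysis.
From Stdlib Require Import Relation_Operators.

Set Implicit Arguments.
Unset Strict Implicit.
Unset Printing Implicit Defensive.

Import Order.TTheory GRing.Theory Num.Theory.
Import numFieldNormedType.Exports.

Local Open Scope classical_set_scope.
Local Open Scope ring_scope.

Record graph := Graph {
  vertex :> choiceType;
  adj : rel vertex;
  graph_nonempty : inhabited vertex;
  adj_sym : symmetric adj;
  adj_irr : irreflexive adj;
  adj_locally_finite : forall x, finite_set [set y | adj x y];
  adj_connected : forall x y, exists2 p, path adj x p & last x p = y
}.

Section Distance.
Variables (T : choiceType) (e : rel T).

Definition walk_lengths (x y : T) : set nat :=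
  [set size p | p in [set p | path e x p /\ last x p = y]].

(* The default value 0 is returned when no walk joins x to y; this does not
   happen for vertices of a graph, nor for vertices of a ball (see ball_adj),
   since a shortest walk from the center stays in the ball. *)
Definition walk_dist (x y : T) : nat :=
  xget 0%N [set n | walk_lengths x y n /\
                    forall m, walk_lengths x y m -> (n <= m)%N].

End Distance.

Definition dist (X : graph) : X -> X -> nat := walk_dist (@adj X).

Section Isometries.
Variable X : graph.

Definition Isom : set (X -> X) :=
  [set phi | bijective phi /\ forall u v, dist (phi u) (phi v) = dist u v].

Definition Isom_orbit (x : X) : set X := [set phi x | phi in Isom].

Definition Isom_stabilizer (x : X) : set (X -> X) :=
  [set phi | Isom phi /\ phi x = x].

Definition cocompact : Prop := finite_set (range Isom_orbit).

End Isometries.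

Definition graph_covering (X Y : graph) (phi : X -> Y) : Prop :=
  [/\ forall y, exists x, phi x = y,
      forall u v, adj u v -> adj (phi u) (phi v) &
      forall x, set_bij [set u | adj x u] [set v | adj (phi x) v] phi].

Section SimplyConnected.
Variables (K : realType) (T : topologicalType).

Definition is_path (f : K -> T) (x y : T) : Prop :=
  [/\ {within `[0, 1], continuous f}, f 0 = x & f 1 = y].

Definition nullhomotopic_loop (f : K -> T) : Prop :=
  exists H : K * K -> T,
    [/\ {within `[0, 1] `*` `[0, 1], continuous H},
        forall t : K, 0 <= t <= 1 -> H (t, 0) = f t,
        forall t : K, 0 <= t <= 1 -> H (t, 1) = f 0 &
        forall s : K, 0 <= s <= 1 -> H (0, s) = f 0 /\ H (1, s) = f 0].

Definition simply_connected : Prop :=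
  [/\ inhabited T,
      forall x y, exists f, is_path f x y &
      forall f x, is_path f x x -> nullhomotopic_loop f].

End SimplyConnected.

Section PolygonalComplex.
Variables (K : realType) (X : graph) (k : nat).

(* A loop (x_0, x_1, ..., x_m = x_0) is encoded as (x_0, [:: x_1; ...; x_m]);
   its length m is the size of the second component. *)
Definition simple_loop (w : X * seq X) : Prop :=
  [/\ path (@adj X) w.1 w.2, last w.1 w.2 = w.1 & uniq w.2].

Definition loop_vertex (w : X * seq X) (i : nat) : X := nth w.1 (w.1 :: w.2) i.

Definition rotate_loop (i : nat) (w : X * seq X) : X * seq X :=
  (last w.1 (take i w.2), rot i w.2).

(* Loops are taken up to cyclic permutation: exactly one representative of each
   class of simple loops of length at most k is retained. *)
Definition faces : set (X * seq X) :=
  [set w | [/\ simple_loop w, (size w.2 <= k)%N &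
               w = xget w (range (rotate_loop ^~ w))]].

(* Both orientations of each edge are listed; they are identified below. *)
Definition edges : set (X * X) := [set e | adj e.1 e.2].

Definition cell : choiceType := (X + set_type edges + set_type faces)%type.

Definition cell_dom (c : cell) : topologicalType :=
  match c with
  | inl (inl _) => set_type [set (0 : K)]
  | inl (inr _) => set_type (`[0, 1]%classic : set K)
  | inr _ => set_type [set z : K * K | z.1 ^+ 2 + z.2 ^+ 2 <= 1]
  end.

Definition cells : topologicalType := {c : cell & cell_dom c}.

Definition vertex_pt (x : X) (o : cell_dom (inl (inl x))) : cells :=
  existT cell_dom (inl (inl x)) o.
Definition edge_pt (e : set_type edges) (t : cell_dom (inl (inr e))) : cells :=
  existT cell_dom (inl (inr e)) t.
Definition face_pt (w : set_type faces) (z : cell_dom (inr w)) : cells :=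
  existT cell_dom (inr w) z.

(* The face of a loop of length m > 0 is glued along its boundary circle by
   sending angle 2 pi (i + t) / m, for i < m and t in [0, 1], to the point at
   distance t from x_i on the edge from x_i to x_(i+1). The boundary of the face
   of a constant loop is collapsed to a point. *)
Inductive cell_glue : cells -> cells -> Prop :=
| glue_endpoint (e : set_type edges) (t : cell_dom (inl (inr e)))
    (o : cell_dom (inl (inl (\val e).1))) :
    \val t = 0 -> cell_glue (edge_pt t) (vertex_pt o)
| glue_flip (e e' : set_type edges) (t : cell_dom (inl (inr e)))
    (t' : cell_dom (inl (inr e'))) :
    \val e' = ((\val e).2, (\val e).1) -> \val t' = 1 - \val t ->
    cell_glue (edge_pt t) (edge_pt t')
| glue_boundary (w : set_type faces) (z : cell_dom (inr w)) (i : nat)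
    (e : set_type edges) (t : cell_dom (inl (inr e))) :
    (i < size (\val w).2)%N ->
    \val e = (loop_vertex (\val w) i, loop_vertex (\val w) i.+1) ->
    (let a := 2 * pi * ((i%:R + \val t) / (size (\val w).2)%:R) in
     \val z = (cos a, sin a)) ->
    cell_glue (face_pt z) (edge_pt t)
| glue_constant (w : set_type faces) (z : cell_dom (inr w))
    (o : cell_dom (inl (inl (\val w).1))) :
    (\val w).2 = [::] -> (\val z).1 ^+ 2 + (\val z).2 ^+ 2 = 1 ->
    cell_glue (face_pt z) (vertex_pt o).

Definition glue_rel : rel cells :=
  fun a b => `[< clos_refl_sym_trans cells cell_glue a b >].

Lemma glue_rel_refl : reflexive glue_rel.
Proof. by move=> a; apply/asboolP; exact: rst_refl. Qed.

Lemma glue_rel_sym : symmetric glue_rel.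
Proof.
by move=> a b; apply/idP/idP => /asboolP ab; apply/asboolP; exact: rst_sym.
Qed.

Lemma glue_rel_trans : transitive glue_rel.
Proof.
by move=> b a c /asboolP ab /asboolP bc; apply/asboolP; exact: rst_trans ab bc.
Qed.

Definition glue_equiv := EquivRel _ glue_rel_refl glue_rel_sym glue_rel_trans.

(* The complex P_k(X), with the quotient topology of the disjoint union of
   its closed cells. *)
Definition polygonal_complex := {eq_quot glue_equiv}%qT.

HB.instance Definition _ :=
  Topological.copy polygonal_complex (quotient_topology polygonal_complex).
HB.instance Definition _ := Quotient.on polygonal_complex.

Definition k_simply_connected : Prop := simply_connected K polygonal_complex.

End PolygonalComplex.

Definition large_scale_simply_connected (K : realType) (X : graph) : Prop :=
  exists k : nat, k_simply_connected K X k.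

Section Balls.
Variables (K : realType) (X : graph) (x : X) (R : K).

Definition graph_ball : set X := [set v | (dist x v)%:R <= R].

(* The edges contained in the closed ball of radius R of the geodesic metric
   space X: the point of the edge {u, v} farthest from x is at distance
   (d(x, u) + d(x, v) + 1) / 2. In particular, for an integer R, an edge between
   two vertices at distance R from x is not contained in the ball. *)
Definition ball_adj : rel X :=
  fun u v => adj u v && (((dist x u + dist x v).+1)%:R / 2 <= R).

Definition ball_dist : X -> X -> nat := walk_dist ball_adj.

End Balls.

(* Isometries between balls are maps between their vertices, sending center to
   center and preserving the intrinsic metrics; only the values of f on the
   ball matter. *)
Definition ball_isometry (K : realType) (X Y : graph) (R : K) (x : X) (y : Y)
    (f : X -> Y) : Prop :=
  [/\ f x = y, set_bij (graph_ball x R) (graph_ball y R) f &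
      forall u v, graph_ball x R u -> graph_ball x R v ->
        ball_dist y R (f u) (f v) = ball_dist x R u v].

Definition R_locally (K : realType) (X : graph) (R : K) (Y : graph) : Prop :=
  forall y : Y, exists (x : X) (f : X -> Y), ball_isometry R x y f.

Definition USLG_rigid_at (K : realType) (X : graph) (r R : K) : Prop :=
  forall Y : graph, R_locally X R Y ->
  forall (x : X) (y : Y) (f : X -> Y), ball_isometry R x y f ->
  exists! phi : X -> Y,
    graph_covering phi /\ (forall u, graph_ball x r u -> phi u = f u).

Definition USLG_rigid (K : realType) (X : graph) : Prop :=
  exists2 r0 : K, 0 < r0 & forall r, r0 <= r ->
  exists2 R : K, r <= R & USLG_rigid_at X r R.

(* Main.v *)
(* If X is rigid, apply uniqueness with Y = X: an isometry fixing x is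
   determined by its restriction to a finite ball.

   Conversely, finiteness of the stabilizers and cocompactness give a radius r0
   such that an isometry fixing some ball of radius r0 pointwise is the identity,
   and an ultralimit argument shows that every isomorphism between sufficiently
   large balls of X agrees on a smaller ball with a global isometry. Hence, for Y
   locally X, the restrictions to r0-balls of isomorphisms from large balls of X
   to balls of Y ("germs") form a local system on X, in which nearby germs have
   unique compatible continuations. Simple connectedness of P_k(X) trivializes
   its monodromy: the open stars of the vertices cover P_k(X), a Lebesgue number
   of the pulled back cover turns a null homotopy into a grid of vertices whose
   neighbouring labels are at distance at most k + 1, and transport along
   consecutive rows of the grid agrees. A global section of germs glues to a
   covering X -> Y extending the given isometry.

   For uniqueness, a covering X -> Y is injective on some ball of minimal
   cardinality, hence on all balls of a slightly smaller radius, so any covering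
   is a local isomorphism at the scale at which germs are rigid. *)
Require Import Defs.
From mathcomp Require Import all_boot all_order all_algebra.
From mathcomp Require Import all_classical all_reals all_analysis.
From mathcomp Require Import finmap.
From mathcomp Require Import lra zify.
From Stdlib Require Import Relation_Operators.

Set Implicit Arguments.
Unset Strict Implicit.
Unset Printing Implicit Defensive.

Import Order.TTheory GRing.Theory Num.Theory.
Import numFieldNormedType.Exports.

Local Open Scope classical_set_scope.
Local Open Scope ring_scope.

(** * Graph distance and local isomorphisms *)

Section WalkDistance.
Local Open Scope nat_scope.

Lemma walk_dist_ex (T : choiceType) (e : rel T) (x y : T) :
    (exists p, path e x p /\ last x p = y) ->
  [/\ exists2 p, path e x p /\ last x p = y & size p = walk_dist e x y &
      forall p, path e x p -> last x p = y -> walk_dist e x y <= size p].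
Proof.
case=> p0 p0P.
have ex : exists n, `[< walk_lengths e x y n >].
  by exists (size p0); apply/asboolP; exists p0.
case: (ex_minnP ex) => n /asboolP wn minn.
rewrite /walk_dist; case: xgetP => [m _ [[p pP <-] pmin]|/(_ n)[]].
  by split=> [|q qp ql]; [exists p|apply: pmin; exists q].
by split=> // m wm; apply: minn; apply/asboolP.
Qed.

Lemma walk_dist_eq1 (T : choiceType) (e : rel T) (x y : T) :
  irreflexive e -> (walk_dist e x y = 1) <-> e x y.
Proof.
move=> irr; split=> [|exy].
  rewrite /walk_dist; case: xgetP => [m _ [[p [pp <-] <-] _]|_ //].
  by case: p pp => [|z [|]] //= /andP[].
have [[p [pp pl] ps] /(_ [:: y])] := @walk_dist_ex _ e x y
  (ex_intro _ [:: y] (conj (introT andP (conj exy isT)) erefl)).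
rewrite /= exy => /(_ isT erefl); rewrite leq_eqVlt => /orP[/eqP//|].
rewrite -ps ltnS leqn0 size_eq0 => /eqP p0; move: pl; rewrite p0 /= => xy.
by move: exy; rewrite xy irr.
Qed.

Variable X : graph.
Implicit Types x y z u v : X.

Lemma dist_path x y :
  exists2 p, path (@adj X) x p /\ last x p = y & size p = dist x y.
Proof.
have [p pp pl] := adj_connected x y.
by have [] := @walk_dist_ex _ (@adj X) x y (ex_intro _ p (conj pp pl)).
Qed.

Lemma dist_le_size x p : path (@adj X) x p -> dist x (last x p) <= size p.
Proof.
move=> pp; have [_ H] := @walk_dist_ex _ (@adj X) x (last x p)
  (ex_intro _ p (conj pp erefl)); exact: H.
Qed.

Lemma distxx x : dist x x = 0.
Proof. by apply/eqP; rewrite -leqn0; exact: (@dist_le_size x [::]). Qed.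

Lemma dist_eq0 x y : dist x y = 0 -> x = y.
Proof. by have [p [_ <-] <-] := dist_path x y => /size0nil ->. Qed.

Lemma dist_eq1 x y : (dist x y = 1) <-> adj x y.
Proof. exact/walk_dist_eq1/adj_irr. Qed.

Lemma dist_adj x y : adj x y -> dist x y = 1.
Proof. by move/dist_eq1. Qed.

Lemma dist_triangle y x z : dist x z <= dist x y + dist y z.
Proof.
have [p [pp pl] <-] := dist_path x y; have [q [qp ql] <-] := dist_path y z.
by rewrite -size_cat -ql -pl -last_cat; apply: dist_le_size; rewrite cat_path pp pl.
Qed.

Lemma dist_sym x y : dist x y = dist y x.
Proof.
suff le (a b : X) : dist a b <= dist b a by apply/eqP; rewrite eqn_leq !le.
have [p [pp <-] <-] := dist_path b a.
have -> : dist (last b p) b = dist (last b p) (last (last b p) (rev (belast b p))).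
  by case: (p) => //= c q; rewrite rev_cons last_rcons.
rewrite -(size_belast b p) -size_rev; apply: dist_le_size.
by rewrite rev_path; apply: sub_path pp => u v; rewrite adj_sym.
Qed.

Lemma dist_triangle_adj x u v : adj u v -> dist x v <= (dist x u).+1.
Proof. by move=> /dist_adj uv; rewrite -addn1 -uv dist_triangle. Qed.

Lemma dist_step x y n : dist x y = n.+1 -> exists2 u, adj u y & dist x u = n.
Proof.
move=> dn; have [p [pp pl] ps] := dist_path x y.
case/lastP: p pp pl ps => [_ _|p z]; first by rewrite dn.
rewrite rcons_path last_rcons size_rcons dn => /andP[pp pz] zy [ps].
rewrite zy in pz; exists (last x p) => //; apply/eqP; rewrite eqn_leq.
rewrite -{1}ps dist_le_size //= -ltnS -dn.
exact: dist_triangle_adj.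
Qed.

Lemma finite_ball x n : finite_set [set u | dist x u <= n].
Proof.
elim: n => [|n IH].
  rewrite (_ : [set _ | _] = [set x]); first exact: finite_set1.
  apply/seteqP; split=> u /=; last by move->; rewrite distxx.
  by rewrite leqn0 => /eqP/dist_eq0.
apply: (@sub_finite_set _ _ ([set u | dist x u <= n] `|`
  \bigcup_(v in [set u | dist x u <= n]) [set u | adj v u])).
  move=> u /=; rewrite leq_eqVlt ltnS => /orP[/eqP/dist_step[v vu dv]|]; last by left.
  by right; exists v => //=; rewrite dv.
rewrite finite_setU; split=> //; apply: bigcup_finite => // v _.
exact: adj_locally_finite.
Qed.

Lemma graph_ind (P : X -> Prop) x :
  P x -> (forall u v, adj u v -> P u -> P v) -> forall y, P y.
Proof.
move=> Px step y; have [p pp <-] := adj_connected x y.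
by elim: p x Px pp => //= z p IH x Px /andP[xz pp]; apply: IH pp; exact: step Px.
Qed.

End WalkDistance.

Section LocalIsomorphisms.
Local Open Scope nat_scope.

(** An isomorphism of the induced subgraphs on the n-balls at [x] and [f x] that also keeps the
    distance to the centre; [f] is total, and its values outside the ball are irrelevant. Distances
    between other points of the ball may change. *)
Definition local_iso (X Y : graph) (n : nat) (x : X) (f : X -> Y) : Prop :=
  [/\ forall u v, dist x u <= n -> dist x v <= n -> f u = f v -> u = v,
      forall u, dist x u <= n -> dist (f x) (f u) = dist x u,
      forall v, dist (f x) v <= n -> exists2 u, dist x u <= n & f u = v &
      forall u v, dist x u <= n -> dist x v <= n -> adj (f u) (f v) = adj u v].

Variables X Y : graph.

Lemma local_iso_inv n (x : X) (f : X -> Y) : local_iso n x f ->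
  exists g : Y -> X, [/\ local_iso n (f x) g,
    forall u, dist x u <= n -> g (f u) = u &
    forall v, dist (f x) v <= n -> f (g v) = v].
Proof.
move=> [inj dst sur ad].
pose g v := xget x [set u | dist x u <= n /\ f u = v].
have gP v : dist (f x) v <= n -> dist x (g v) <= n /\ f (g v) = v.
  by move=> /sur[u un fu]; rewrite /g; case: xgetP => [w _ [//]|/(_ u)[]].
have gK u : dist x u <= n -> g (f u) = u.
  by move=> un; have := un; rewrite -(dst _ un) => /gP[gn ge]; apply: inj.
have gx : g (f x) = x by apply: gK; rewrite distxx.
exists g; split=> // [|v /gP[]//]; split.
- by move=> u v /gP[_ eu] /gP[_ ev] e; rewrite -eu -ev e.
- by move=> v /gP[vn ev]; rewrite gx -[in RHS]ev dst.
- by move=> u; rewrite gx => un; exists (f u); rewrite ?dst ?gK.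
- by move=> u v /gP[un eu] /gP[vn ev]; rewrite -[in RHS]eu -[in RHS]ev ad.
Qed.

(** A geodesic from [u] to [v] stays in the n-ball at [x], so its image is a walk of the same
    length. *)
Lemma local_iso_dist_le n (x u v : X) (f : X -> Y) : local_iso n x f ->
  dist x u + dist u v <= n -> dist (f u) (f v) <= dist u v.
Proof.
move=> [_ _ _ ad].
have [p [pp <-] <-] := dist_path u v => ple.
have -> : f (last u p) = last (f u) (map f p) by rewrite last_map.
rewrite -(size_map f p); apply: dist_le_size.
elim: p u pp ple => //= w p IH u /andP[uw pp] ple.
have le : dist x w <= (dist x u).+1 by exact: dist_triangle_adj.
rewrite ad ?uw /=; [|lia|lia].
by apply: IH => //; lia.
Qed.
End LocalIsomorphisms.

(** The inequality just proved, applied to [f] and to its local inverse, gives both bounds. *)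
Lemma local_iso_dist (X Y : graph) (n : nat) (x u v : X) (f : X -> Y) :
    local_iso n x f -> (dist x u + dist u v <= n)%N -> dist (f u) (f v) = dist u v.
Proof.
move=> fi uv; apply/eqP; rewrite eqn_leq (local_iso_dist_le fi uv) /=.
have [g [gi gf fg]] := local_iso_inv fi.
have [_ dst _ _] := fi.
have un : (dist x u <= n)%N by lia.
have vn : (dist x v <= n)%N by apply: leq_trans uv; exact: dist_triangle.
rewrite -{1}(gf u un) -{1}(gf v vn); apply: (local_iso_dist_le gi).
by rewrite dst //; have := local_iso_dist_le fi uv; lia.
Qed.

Section LocalIsomorphismCalculus.
Local Open Scope nat_scope.
Variables X Y Z : graph.

(** The condition on [m] puts the m-ball at [u] inside the n-ball at [x]. Surjectivity onto the
    m-ball at [f u] holds because the local inverse preserves distances from [f u] there. *)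
Lemma local_iso_recenter m n (x u : X) (f : X -> Y) : local_iso n x f ->
  dist x u + m <= n -> local_iso m u f.
Proof.
move=> fi um; have [inj dst sur ad] := fi.
have sub v : dist u v <= m -> dist x v <= n.
  by have := dist_triangle u x v; lia.
split.
- by move=> v w /sub vn /sub wn; apply: inj.
- by move=> v vm; rewrite (local_iso_dist fi) //; lia.
- have [g [gi gf fg]] := local_iso_inv fi.
  have un : dist x u <= n by lia.
  move=> v vm; have fuv : dist (f x) (f u) + dist (f u) v <= n by rewrite dst //; lia.
  exists (g v); last first.
    by rewrite fg //; apply: leq_trans fuv; exact: dist_triangle.
  by rewrite -(gf u un) (local_iso_dist gi fuv).
- by move=> v w /sub vn /sub wn; apply: ad.
Qed.

Lemma local_iso_le m n (x : X) (f : X -> Y) :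
  m <= n -> local_iso n x f -> local_iso m x f.
Proof. by move=> mn fi; apply: local_iso_recenter fi _; rewrite distxx. Qed.

Lemma local_iso_comp n (x : X) (f : X -> Y) (g : Y -> Z) :
  local_iso n x f -> local_iso n (f x) g -> local_iso n x (g \o f).
Proof.
move=> [fi fd fs fa] [gi gd gs ga]; split=> /=.
- by move=> u v un vn /gi; rewrite !fd // => /(_ un vn); apply: fi.
- by move=> u un; rewrite gd fd.
- by move=> w /gs[v vn <-]; have [u un <-] := fs _ vn; exists u.
- by move=> u v un vn; rewrite ga ?fd // fa.
Qed.

Lemma Isom_adj (phi : X -> X) u v : Isom phi -> adj (phi u) (phi v) = adj u v.
Proof.
by move=> [_ dphi]; apply/idP/idP => /dist_eq1 h; apply/dist_eq1; rewrite -h ?dphi.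
Qed.

Lemma Isom_local_iso (phi : X -> X) n x : Isom phi -> local_iso n x phi.
Proof.
move=> phiI; have [[psi phiK psiK] dphi] := phiI; split.
- by move=> u v _ _ /(can_inj phiK).
- by move=> u _; rewrite dphi.
- by move=> v; rewrite -{1}(psiK v) dphi; exists (psi v).
- by move=> u v _ _; rewrite Isom_adj.
Qed.

Lemma Isom_id : Isom (id : X -> X).
Proof. by split=> //; exists id. Qed.

Lemma Isom_comp (phi psi : X -> X) : Isom phi -> Isom psi -> Isom (phi \o psi).
Proof.
move=> [bphi dphi] [bpsi dpsi]; split; first exact: bij_comp.
by move=> u v /=; rewrite dphi dpsi.
Qed.

Lemma Isom_inv (phi : X -> X) : Isom phi ->
  exists psi, [/\ Isom psi, cancel phi psi & cancel psi phi].
Proof.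
move=> [[psi phiK psiK] dphi]; exists psi; split=> //; split; first by exists phi.
by move=> u v; rewrite -dphi !psiK.
Qed.

End LocalIsomorphismCalculus.

(** * Open stars in the polygonal complex *)

Section Stars.
Variables (K : realType) (X : graph) (k : nat).

(** The trace of the open star of [x] on an edge running from [a] at [t = 0] to [b] at [t = 1]: the
    end opposite to [x] is removed. *)
Definition edge_star (x a b : X) : set K :=
  [set t | (a = x /\ t != 1) \/ (b = x /\ t != 0)].

(** The boundary of the m-gon as the unit circle, with [u] measured in edge lengths. *)
Definition circle_pt (m : nat) (u : K) : K * K :=
  (cos (2 * pi * (u / m%:R)), sin (2 * pi * (u / m%:R))).

(* A boundary point of a face has several angular parameters (i, t); quantifying
   universally over them makes the star of x in the closed disc the complement
   of finitely many compact arcs. *)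
Definition open_star (x : X) : set (cells K X k) := fun c =>
  let: existT d p := c in
  match d return cell_dom K d -> Prop with
  | inl (inl y) => fun=> y = x
  | inl (inr e) => fun t => edge_star x (\val e).1 (\val e).2 (\val t)
  | inr w => fun z =>
      x \in (\val w).1 :: (\val w).2 /\
      forall (i : nat) (t : K), (i < size (\val w).2)%N -> 0 <= t <= 1 ->
        \val z = circle_pt (size (\val w).2) (i%:R + t) ->
        edge_star x (loop_vertex (\val w) i) (loop_vertex (\val w) i.+1) t
  end p.

Lemma cos_eq1_2pi (c : K) : 0 <= c <= 2 * pi -> cos c = 1 -> c = 0 \/ c = 2 * pi.
Proof.
move=> /andP[c0 c2] c1; have pi0 := @pi_ge0 K.
case: (leP c pi) => cpi.
  by left; apply: cos_inj; rewrite ?cos0 // in_itv /= ?lexx ?c0.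
right; suff : 2 * pi - c = 0 by move/eqP; rewrite subr_eq0 => /eqP.
have cb : 0 <= 2 * pi - c <= pi by move: cpi c2; clear c1; move: (pi : K) => q; lra.
apply: cos_inj; rewrite ?in_itv /= ?lexx ?cb ?pi_ge0 //.
by rewrite cos0 addrC mulr_natl cosD2pi cosN.
Qed.

(** Up to exchanging [u] and [v], the angles differ by an element of [0, 2 pi] with cosine 1, hence
    by 0 or by a full turn. *)
Lemma circle_pt_inj (m : nat) (u v : K) : (0 < m)%N ->
    0 <= u <= m%:R -> 0 <= v <= m%:R -> circle_pt m u = circle_pt m v ->
  u = v \/ `|u - v| = m%:R.
Proof.
move=> m0; have m0' : 0 < m%:R :> K by rewrite ltr0n.
wlog uv : u v / v <= u.
  move=> H hu hv e; case: (leP v u) => [vu|/ltW uv]; first exact: H.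
  by case: (H v u uv hv hu (esym e)) => [->|]; [left|rewrite distrC; right].
move=> /andP[u0 um] /andP[v0 vm] [ec es].
have pi0 := @pi_gt0 K.
have : cos (2 * pi * (u / m%:R) - 2 * pi * (v / m%:R)) = 1.
  by rewrite cosB ec es -!expr2 cos2Dsin2.
rewrite -mulrBr -mulrBl => /cos_eq1_2pi[].
- rewrite mulr_ge0 ?mulr_ge0 ?divr_ge0 ?subr_ge0 ?(ltW pi0) ?(ltW m0') //=.
  by rewrite ler_piMr ?mulr_ge0 ?(ltW pi0) // ler_pdivrMr // mul1r; lra.
- move/eqP; rewrite !mulf_eq0 invr_eq0 (gt_eqF pi0) (gt_eqF m0') pnatr_eq0 /=.
  by rewrite orbF subr_eq0 => /eqP; left.
- move/(canRL (mulKf _)); rewrite mulf_neq0 ?(gt_eqF pi0) ?pnatr_eq0 // => /(_ isT).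
  rewrite mulVf ?mulf_neq0 ?(gt_eqF pi0) ?pnatr_eq0 // => /divr1_eq e.
  by right; rewrite ger0_norm ?subr_ge0.
Qed.

(** Two different parameters of one boundary point describe a corner: either the common end of
    consecutive sides, or the base vertex, reached both at 0 and at the full length. At a corner
    both memberships say that this corner is [x]. *)
Lemma edge_star_loop (w : X * seq X) (x : X) (i j : nat) (t s : K) :
    simple_loop w -> (i < size w.2)%N -> (j < size w.2)%N ->
    0 <= t <= 1 -> 0 <= s <= 1 ->
    circle_pt (size w.2) (i%:R + t) = circle_pt (size w.2) (j%:R + s) ->
  edge_star x (loop_vertex w i) (loop_vertex w i.+1) t ->
  edge_star x (loop_vertex w j) (loop_vertex w j.+1) s.
Proof.
move=> [_ wl _] im jm t01 s01.
set m := size w.2 in im jm *.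
have m0 : (0 < m)%N by apply: leq_ltn_trans im.
have bnd (l : nat) (r : K) : (l < m)%N -> 0 <= r <= 1 -> 0 <= l%:R + r <= m%:R.
  move=> lm /andP[r0 r1]; rewrite addr_ge0 //=.
  have : l.+1%:R <= m%:R :> K by rewrite ler_nat.
  by rewrite -natr1; lra.
have closing : loop_vertex w m = loop_vertex w 0.
  by rewrite /loop_vertex -[RHS]/w.1 -[in RHS]wl -nth_last /= -/m; case: (m) m0.
have nextpos (a b : nat) : (a < b)%N -> a.+1%:R <= b%:R :> K by rewrite ler_nat.
move/(circle_pt_inj m0 (bnd _ _ im t01) (bnd _ _ jm s01)) => [e|e].
- case: (ltngtP i j) => ij.
  + have := nextpos _ _ ij; rewrite -natr1 => h.
    have t1 : t = 1 by lra.
    have s0 : s = 0 by lra.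
    have -> : j = i.+1 by apply/eqP; rewrite -(eqr_nat K) -natr1; apply/eqP; lra.
    by rewrite t1 s0 /edge_star /= !eqxx => -[[]//|[-> _]]; left; rewrite eq_sym oner_eq0.
  + have := nextpos _ _ ij; rewrite -natr1 => h.
    have t0 : t = 0 by lra.
    have s1 : s = 1 by lra.
    have -> : i = j.+1 by apply/eqP; rewrite -(eqr_nat K) -natr1; apply/eqP; lra.
    by rewrite t0 s1 /edge_star /= !eqxx => -[[-> _]|[]//]; right; rewrite oner_eq0.
  + by have -> : s = t by [apply/esym/(addrI j%:R); rewrite -{1}ij]; rewrite ij.
- have ends (a b : nat) (p q : K) : (a < m)%N -> (b < m)%N -> 0 <= p <= 1 ->
      0 <= q <= 1 -> (b%:R + q) - (a%:R + p) = m%:R ->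
      [/\ a = 0%N, p = 0, b.+1 = m & q = 1].
    move=> am bm p01 q01 d; have := nextpos _ _ bm; rewrite -natr1 => h.
    have a0 : 0 <= a%:R :> K by rewrite ler0n.
    split; [|lra| |lra].
    + by apply/eqP; rewrite -(eqr_nat K); apply/eqP; lra.
    + by apply/eqP; rewrite -(eqr_nat K) -natr1; apply/eqP; lra.
  move: e => /eqP; rewrite eqr_norml => /andP[/orP[]/eqP e _].
  + have [-> -> e1 ->] := ends _ _ _ _ jm im s01 t01 e.
    rewrite e1 closing /edge_star /= !eqxx => -[[]//|[-> _]].
    by left; rewrite eq_sym oner_eq0.
  + have [-> -> e1 ->] : [/\ i = 0%N, t = 0, j.+1 = m & s = 1].
      by apply: ends => //; rewrite -opprB e opprK.
    rewrite e1 closing /edge_star /= !eqxx => -[[-> _]|[]//].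
    by right; rewrite oner_eq0.
Qed.

Lemma loop_vertex_mem (w : X * seq X) (j : nat) :
  (j <= size w.2)%N -> loop_vertex w j \in w.1 :: w.2.
Proof. by move=> jm; rewrite /loop_vertex mem_nth //= ltnS. Qed.

(** This invariance lets stars pass to the quotient. On a face boundary, membership for one angular
    parameter implies it for all; for a constant loop there is no parameter to check. *)
Lemma cell_glue_star (x : X) (c c' : cells K X k) :
  cell_glue c c' -> open_star x c <-> open_star x c'.
Proof.
case=> [e t o t0|e e' t t' ee' tt'|w z i e t im ew az|w z o w0 z1].
- rewrite /= /edge_star /= t0 eqxx eq_sym oner_eq0.
  by split=> [[[]//|[]//]|->]; left.
- rewrite /= /edge_star /= tt' ee' /=.
  have -> : (1 - \val t == 1) = (\val t == 0).
    by apply/eqP/eqP => h; lra.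
  by rewrite subr_eq0 (eq_sym 1); tauto.
- have wl := set_valP w; have [[wp wl1 wu] _ _] := wl.
  rewrite /= ew /=; split=> [[_ H]|H].
    apply: H => //; have := set_valP t; rewrite /= in_itv /=; exact.
  have t01 : 0 <= \val t <= 1 by have := set_valP t; rewrite /= in_itv /=; exact.
  split; first by case: H => -[<- _]; apply: loop_vertex_mem => //; exact: ltnW.
  move=> j s jm s01 zs; apply: edge_star_loop H => //.
  by rewrite -[LHS]/(circle_pt _ _) -zs az.
- rewrite /= w0 /= inE; split=> [[/eqP ->] //|<-]; split; rewrite ?eqxx //.
Qed.

Definition complex_star (x : X) : set (polygonal_complex K X k) :=
  fun q => open_star x (repr q).

Lemma complex_star_pi (x : X) (c : cells K X k) :
  complex_star x (\pi c)%qT <-> open_star x c.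
Proof.
rewrite /complex_star; case: piP => d /eqmodP /asboolP.
elim=> [a b /cell_glue_star ab|//|a b _ H|a b e _ H1 _ H2].
- exact: iff_sym (ab x).
- exact: iff_sym.
- exact: iff_trans H2 H1.
Qed.

Lemma open_edge_star (x a b : X) : open (edge_star x a b : set K).
Proof.
have o (P : Prop) (r : K) : open [set t : K | P /\ t != r].
  have [p|np] := pselect P.
    rewrite (_ : [set _ | _] = ~` [set r]).
      by apply: closed_openC; exact/accessible_closed_set1/hausdorff_accessible/Rhausdorff.
    by apply/seteqP; split=> [t [_ /eqP]//|t /= /eqP]; split.
  rewrite (_ : [set _ | _] = set0); first exact: open0.
  by apply/seteqP; split=> t // [/np].
rewrite (_ : edge_star x a b =
  [set t | a = x /\ t != 1] `|` [set t | b = x /\ t != 0]) //; exact: openU.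
Qed.

Lemma continuous_circle_pt (m : nat) : continuous (circle_pt m : K -> K * K).
Proof.
have c : continuous (fun u : K => 2 * pi * (u / m%:R)).
  move=> u; apply: cvgM; first exact: cvg_cst.
  by apply: cvgM; [exact: cvg_id|exact: cvg_cst].
move=> u; rewrite /circle_pt.
apply: (@cvg_pair _ _ _ (nbhs u) (nbhs (cos (2 * pi * (u / m%:R))))
  (nbhs (sin (2 * pi * (u / m%:R))))).
  by apply: (cvg_comp _ _ (c u)); exact: continuous_cos.
by apply: (cvg_comp _ _ (c u)); exact: continuous_sin.
Qed.

Lemma open_open_star (x : X) : open (open_star x : set (cells K X k)).
Proof.
apply/sigT_openP => -[[y|e]|w].
- have [yx|yx] := pselect (y = x).
    rewrite (_ : _ @^-1` _ = setT); first exact: openT.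
    by apply/seteqP; split.
  rewrite (_ : _ @^-1` _ = set0); first exact: open0.
  by apply/seteqP; split.
- have oe := @open_edge_star x (\val e).1 (\val e).2.
  rewrite (_ : _ @^-1` _ = (@set_val _ _) @^-1` (edge_star x (\val e).1 (\val e).2)) //.
  by apply: open_comp => // t _; exact: initial_continuous.
- have [xw|xw] := boolP (x \in (\val w).1 :: (\val w).2); last first.
    rewrite (_ : _ @^-1` _ = set0); first exact: open0.
    by apply/seteqP; split=> // z [] /=; rewrite (negbTE xw).
  set m := size (\val w).2.
  pose C := \bigcup_(i in `I_m) ((fun t : K => circle_pt m (i%:R + t)) @`
    (`[0, 1] `&` ~` edge_star x (loop_vertex (\val w) i) (loop_vertex (\val w) i.+1))).
  have Cc : closed C.
    apply: closed_bigcup; first exact: finite_II.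
    move=> i _; apply: compact_closed; first exact: norm_hausdorff.
    apply: continuous_compact.
      apply: continuous_subspaceT => t.
      apply: (@continuous_comp _ _ _ _ (circle_pt m)); last exact: continuous_circle_pt.
      by apply: cvgD; [exact: cvg_cst|exact: cvg_id].
    apply: subclosed_compact (@segment_compact K 0 1) _; last by move=> ? [].
    apply: closedI; first exact: itv_closed.
    by apply: open_closedC; exact: open_edge_star.
  rewrite (_ : _ @^-1` _ = (@set_val _ _) @^-1` (~` C)).
    apply: open_comp; last exact: closed_openC.
    by move=> t _; exact: initial_continuous.
  apply/seteqP; split=> z /=.
    move=> [_ H] [i /= im [t [+ nt] tz]]; rewrite /= in_itv /= => t01.
    by apply: nt; apply: (H i t im) => //; rewrite -tz.
  move=> H; split=> // i t im t01 zt; apply: contrapT => nt; apply: H.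
  exists i => //; exists t => //; split=> //; rewrite /= in_itv /=; exact: t01.
Qed.

Lemma open_complex_star (x : X) : open (complex_star x).
Proof.
(* By definition of the quotient topology, the goal is openness of the preimage under the
   projection, which is [open_star x]. *)
have := @open_open_star x; congr open; apply/seteqP; split=> c.
  by move/complex_star_pi.
by move=> h; apply/complex_star_pi.
Qed.

Lemma edge_star_ex (a b : X) (t : K) : exists x, edge_star x a b t.
Proof.
have [->|t1] := eqVneq t 1; last by exists a; left.
by exists b; right; rewrite oner_eq0.
Qed.

(** A face point without angular parameter lies in the star of every vertex of its loop; for a
    boundary point, an [x] comes from the star on a side through it. *)
Lemma complex_star_cover (q : polygonal_complex K X k) : exists x, complex_star x q.
Proof.
rewrite /complex_star; case: (repr q) => -[[y|e] p|w z].
- by exists y.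
- by have [x] := edge_star_ex (\val e).1 (\val e).2 (\val p); exists x.
- have [[i [t [im t01 zt]]]|H] := pselect (exists i (t : K),
      [/\ (i < size (\val w).2)%N, 0 <= t <= 1 &
          \val z = circle_pt (size (\val w).2) (i%:R + t)]).
    have [x xt] := edge_star_ex (loop_vertex (\val w) i) (loop_vertex (\val w) i.+1) t.
    have [sl _ _] := set_valP w.
    exists x; split.
      by case: xt => -[<- _]; apply: loop_vertex_mem => //; exact: ltnW.
    move=> j s jm s01 zs; apply: edge_star_loop xt => //.
    by rewrite -zs -zt.
  exists (\val w).1; split; first by rewrite inE eqxx.
  by move=> i t im t01 zt; exfalso; apply: H; exists i, t.
Qed.

End Stars.

(** * Distance between vertices with intersecting stars *)

Section NerveDistance.
Variables (K : realType) (X : graph) (k : nat).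

Lemma path_dist_nth (x : X) (p : seq X) (i j : nat) :
    path (@adj X) x p -> (i <= j <= size p)%N ->
  (dist (nth x (x :: p) i) (nth x (x :: p) j) <= j - i)%N.
Proof.
move=> pp /andP[]; elim: j => [|j IH].
  by rewrite leqn0 => /eqP ->; rewrite distxx.
rewrite leq_eqVlt ltnS => /orP[/eqP-> _|ij jp]; first by rewrite distxx.
rewrite subSn //; apply: leq_trans (dist_triangle_adj _ _) _.
  exact: (pathP x pp j jp).
by rewrite ltnS; apply: IH => //; exact: ltnW.
Qed.

Lemma path_dist (x u v : X) (p : seq X) : path (@adj X) x p ->
  u \in x :: p -> v \in x :: p -> (dist u v <= size p)%N.
Proof.
move=> pp /(nthP x)[i ip <-] /(nthP x)[j jp <-]; rewrite /= !ltnS in ip jp.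
wlog ij : i j ip jp / (i <= j)%N.
  move=> H; case: (leqP i j) => [|/ltnW] ij; first exact: H.
  by rewrite dist_sym; apply: H.
apply: leq_trans (path_dist_nth pp _) _; first by rewrite ij.
exact: leq_trans (leq_subr _ _) jp.
Qed.

(** Vertices whose stars share a point lie on a common cell: a vertex, an edge, or a loop of length
    at most [k]. The bound is [k.+1] so that edges are covered also for [k = 0]. *)
Lemma complex_star_dist (x y : X) (q : polygonal_complex K X k) :
  complex_star x q -> complex_star y q -> (dist x y <= k.+1)%N.
Proof.
rewrite /complex_star; case: (repr q) => -[[v|e] p|w z] /=.
- by move=> -> ->; rewrite distxx.
- have ab : adj (\val e).1 (\val e).2 := set_valP e.
  move=> -[[<- _]|[<- _]] [[<- _]|[<- _]]; rewrite ?distxx // ?(dist_adj ab) //.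
  by rewrite dist_sym (dist_adj ab).
- have [[wp _ _] wk _] := set_valP w.
  move=> [xw _] [yw _]; apply: leq_trans (path_dist wp xw yw) _; exact: leqW.
Qed.

End NerveDistance.

(** * Walks as continuous paths in the complex *)

Section EdgePaths.
Variables (K : realType) (X : graph) (k : nat).
Local Notation complex := (polygonal_complex K X k).

Definition complex_pi (c : cells K X k) : complex := (\pi_(complex) c)%qT.

Definition complex_vertex (x : X) : complex :=
  complex_pi (@vertex_pt K X k x (exist _ 0 (mem_set erefl))).

Lemma complex_star_vertex (x y : X) : complex_star x (complex_vertex y) -> y = x.
Proof. by move/complex_star_pi. Qed.

Lemma clip_in (t : K) : (Num.max 0 (Num.min 1 t)) \in (`[0, 1]%classic : set K).
Proof.
by apply: mem_set; rewrite /= in_itv /= le_max lexx /= ge_max ler01 ge_min lexx.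
Qed.

Definition clip (t : K) : set_type (`[0, 1]%classic : set K) :=
  exist (fun s => s \in (`[0, 1]%classic : set K)) _ (clip_in t).

Lemma continuous_clip : continuous clip.
Proof.
apply/continuousP => A [B oB <-].
rewrite (_ : _ @^-1` _ = (fun t : K => Num.max 0 (Num.min 1 t)) @^-1` B) //.
have c : continuous (fun t : K => Num.max 0 (Num.min 1 t)).
  move=> t; apply: continuous_max; first exact: cvg_cst.
  by apply: continuous_min; [exact: cvg_cst|exact: cvg_id].
by move/continuousP: c; apply.
Qed.

(** Clamping the parameter to [0, 1], and using a constant path for non-adjacent ends, makes this
    total and continuous on all of [K]. *)
Definition edge_path (a b : X) (t : K) : complex :=
  if pselect (adj a b) is left ab
  then complex_pi (@edge_pt K X k (exist _ (a, b) (mem_set ab)) (clip t))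
  else complex_vertex a.

Lemma complex_glue (c d : cells K X k) : cell_glue c d -> complex_pi c = complex_pi d.
Proof. by move=> cd; apply/eqmodP/asboolP; exact: rst_step. Qed.

Lemma edge_path_continuous (a b : X) : continuous (edge_path a b).
Proof.
rewrite /edge_path; case: pselect => [ab|_]; last by move=> t; exact: cvg_cst.
set e := exist _ _ _.
have ce : continuous (fun s : cell_dom K (inl (inr e)) => complex_pi (@edge_pt K X k e s)).
  move=> s U /(@pi_continuous _ complex).
  exact: (@existT_continuous _ (@cell_dom K X k)).
move=> t; exact: (@continuous_comp _ _ _ clip _ t (@continuous_clip t) (ce (clip t))).
Qed.

Lemma edge_path_le0 (a b : X) (t : K) : t <= 0 -> edge_path a b t = complex_vertex a.
Proof.
move=> t0; rewrite /edge_path; case: pselect => // ab.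
apply: complex_glue; apply: glue_endpoint => /=.
by apply/eqP; rewrite eq_le le_max lexx ge_max lexx ge_min t0 orbT.
Qed.

Lemma edge_path_ge1 (a b : X) (t : K) : adj a b -> 1 <= t ->
  edge_path a b t = complex_vertex b.
Proof.
move=> ab t1; rewrite /edge_path; case: pselect => // {}ab.
have ba : adj b a by rewrite adj_sym.
have c1 : Num.max 0 (Num.min 1 t) = 1 by rewrite min_l // max_r.
(* The gluing names only the initial end of an oriented edge, so the final end is read off from the
   reversed edge. *)
have -> : complex_vertex b = edge_path b a 0 by rewrite edge_path_le0.
rewrite /edge_path; case: pselect => // {}ba.
apply: complex_glue; apply: glue_flip => //=.
by rewrite c1 subrr min_r // maxxx.
Qed.

Lemma complex_star_edge (x a b : X) (t : K) :
  complex_star x (edge_path a b t) -> x = a \/ x = b.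
Proof.
rewrite /edge_path; case: pselect => [ab|_ /complex_star_vertex]; last by left.
by move/complex_star_pi => /= -[[]|[]]; [left|right].
Qed.

Lemma continuous_patch_le (T : topologicalType) (f g : K -> T) (c : K) :
    continuous f -> continuous g -> f c = g c ->
  continuous (fun t => if t <= c then f t else g t).
Proof.
move=> cf cg fg t U /= Uh.
have H : t <= c -> nbhs t (fun s => U (f s)).
  by move=> tc; apply: cf; rewrite tc in Uh.
have H' : c <= t -> nbhs t (fun s => U (g s)).
  move=> ct; apply: cg; move: Uh; case: ifP => // tc.
  by have -> : t = c by [apply/le_anti; rewrite tc ct]; rewrite fg.
rewrite nbhs_simpl; change (\forall s \near t, U (if s <= c then f s else g s)).
have [tc|ct|tc] := ltgtP t c.
- near=> s; rewrite ifT; first by near: s; exact: H (ltW tc).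
  by rewrite ltW //; near: s; exact: lt_nbhsl.
- near=> s; rewrite ifF; first by near: s; exact: H' (ltW ct).
  by apply/negbTE; rewrite -ltNge; near: s; exact: lt_nbhsr.
- by near=> s; case: ifP => _; near: s; [apply: H|apply: H']; rewrite tc.
Unshelve. all: by end_near. Qed.

Fixpoint walk_path (x : X) (p : seq X) (t : K) : complex :=
  if p is y :: q then
    if t <= 1 then edge_path x y t else walk_path y q (t - 1)
  else complex_vertex x.

Lemma walk_path0 (x : X) (p : seq X) : walk_path x p 0 = complex_vertex x.
Proof. by case: p => //= y q; rewrite ler01 edge_path_le0. Qed.

Lemma walk_path_size (x : X) (p : seq X) : path (@adj X) x p ->
  walk_path x p (size p)%:R = complex_vertex (last x p).
Proof.
elim: p x => //= y q IH x /andP[xy qp]; rewrite -natr1.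
case: leP => [q0|_]; last by rewrite addrK IH.
have : q = [::] by case: (q) q0 => //= z r; rewrite gerDr lern0.
by move=> -> /=; rewrite add0r edge_path_ge1.
Qed.

Lemma walk_path_continuous (x : X) (p : seq X) : path (@adj X) x p ->
  continuous (walk_path x p).
Proof.
elim: p x => [|y q IH] x /=; first by move=> _ t; exact: cvg_cst.
move=> /andP[xy qp]; apply: continuous_patch_le.
- exact: edge_path_continuous.
- have c1 : continuous (fun s : K => s - 1).
    by move=> s; apply: cvgB; [exact: cvg_id|exact: cvg_cst].
  move=> t; exact: (@continuous_comp _ _ _ (fun s : K => s - 1) (walk_path y q) t
    (c1 t) (IH y qp (t - 1))).
- by rewrite subrr walk_path0 edge_path_ge1.
Qed.

Lemma walk_path_star (x z : X) (p : seq X) (j : nat) (t : K) :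
    path (@adj X) x p -> (j < size p)%N -> j%:R <= t <= j.+1%:R ->
    complex_star z (walk_path x p t) ->
  z = nth x (x :: p) j \/ z = nth x (x :: p) j.+1.
Proof.
elim: p x j t => [//|y q IH] x [|j] t /=.
  by move=> _ _ /andP[_ ->] /complex_star_edge.
move=> /andP[xy qp]; rewrite ltnS => jq /andP[jt tj]; case: leP => [t1|t1].
  (* A positive index together with [t <= 1] leaves only the junction [t = 1], where the point is a
     vertex. *)
  have j0 : j = 0%N.
    by apply/eqP; rewrite -leqn0 -(ler_nat K); rewrite -natr1 in jt; lra.
  rewrite edge_path_ge1 //; last by rewrite j0 in jt.
  by move=> /complex_star_vertex <-; left; rewrite j0.
rewrite !(set_nth_default y x) //; last exact: ltnW.
apply: IH => //; rewrite -natr1 in jt; rewrite -natr1 in tj; apply/andP; split; lra.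
Qed.
End EdgePaths.

(** * Monodromy of local systems on a k-simply connected graph *)

Section Lebesgue.
Variables (K : realType) (T : topologicalType) (I : Type) (O : I -> set T).
Local Notation square := (`[0, 1] `*` `[0, 1] : set (K * K)).

(** Near-covering compactness makes a locally valid scale uniform. Half of the local radius [e]
    absorbs the move from [z] to [z'], the other half the mesh. *)
Lemma square_lebesgue_number (H : K * K -> T) :
    {within square, continuous H} -> (forall i, open (O i)) ->
    (forall q, exists i, O i q) ->
  exists n0 : nat, forall n, (n0 <= n)%N -> forall z, square z ->
    exists i, forall z', square z' ->
      `|z.1 - z'.1| <= n.+1%:R^-1 -> `|z.2 - z'.2| <= n.+1%:R^-1 -> O i (H z').
Proof.
move=> cH oO covO.
have csq : compact square by apply: compact_setX; exact: segment_compact.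
move/compact_near_coveringP: csq => /(_ nat \oo (fun n z => exists i, forall z', square z' ->
      `|z.1 - z'.1| <= n.+1%:R^-1 -> `|z.2 - z'.2| <= n.+1%:R^-1 -> O i (H z')) _)[].
  move=> z zS; have [i Oi] := covO (H z).
  have : nbhs z (fun z' => square z' -> O i (H z')).
    have /subspace_continuousP/(_ z zS) := cH; apply.
    exact: open_nbhs_nbhs (conj (oO i) Oi).
  move=> /nbhs_ballP[e /= e0 eb].
  have e20 : 0 < e / 2 by rewrite divr_gt0.
  near=> z' n; exists i => z'' z''S /= d1 d2; apply: eb => //.
  have zz : ball z (e / 2) z' by near: z'; exact: nbhsx_ballx.
  have ne : n.+1%:R^-1 < e / 2 :> K.
    by near: n; exact: near_infty_natSinv_lt (PosNum e20).
  move: zz => [/= z1 z2]; rewrite /ball /= in z1 z2.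
  split; rewrite /ball /=.
  - rewrite -(subrKA z'.1); apply: le_lt_trans (ler_normD _ _) _.
    by rewrite [e]splitr ltrD // (le_lt_trans d1).
  - rewrite -(subrKA z'.2); apply: le_lt_trans (ler_normD _ _) _.
    by rewrite [e]splitr ltrD // (le_lt_trans d2).
move=> n0 _ Hn; exists n0 => n n0n z zS; exact: Hn.
Unshelve. all: by end_near. Qed.
End Lebesgue.

(** * Local systems and transport along vertex sequences *)

Section LocalSystems.
Variables (X : graph) (F : Type) (L : nat) (fib : X -> F -> Prop) (tr : X -> X -> F -> F).

(** A locally constant family of sets over the Rips complex of [X] at scale [L]: the fibre over [x]
    is cut out of [F] by [fib x], and the last clause is the cocycle condition on triangles. *)
Definition local_system : Prop :=
  [/\ forall x y e, (dist x y <= L)%N -> fib x e -> fib y (tr x y e),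
      forall x e, fib x e -> tr x x e = e &
      forall x y z e, (dist x y <= L)%N -> (dist y z <= L)%N -> (dist x z <= L)%N ->
        fib x e -> tr y z (tr x y e) = tr x z e].

Fixpoint transport (a : nat -> X) (n : nat) (e : F) : F :=
  if n is m.+1 then tr (a m) (a m.+1) (transport a m e) else e.

Fixpoint walk_transport (x : X) (p : seq X) (e : F) : F :=
  if p is y :: q then walk_transport y q (tr x y e) else e.

Hypothesis LS : local_system.

Lemma transport_fib (a : nat -> X) (n : nat) (e : F) :
    (forall i, (i < n)%N -> (dist (a i) (a i.+1) <= L)%N) ->
  fib (a 0%N) e -> fib (a n) (transport a n e).
Proof.
have [trF _ _] := LS; elim: n => //= n IH aL ae.
by apply: trF; [exact: aL|apply: IH => // i /ltnW; exact: aL].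
Qed.

(** Each square of the ladder is cut by the diagonal from [a i] to [b i.+1], and both halves commute
    by the cocycle condition. *)
Lemma transport_ladder (a b : nat -> X) (n : nat) (e : F) :
    (forall i, (i < n)%N -> [/\ (dist (a i) (a i.+1) <= L)%N,
      (dist (b i) (b i.+1) <= L)%N & (dist (a i) (b i.+1) <= L)%N]) ->
    (forall i, (i <= n)%N -> (dist (a i) (b i) <= L)%N) -> fib (a 0%N) e ->
  tr (a n) (b n) (transport a n e) = transport b n (tr (a 0%N) (b 0%N) e).
Proof.
have [trF tr1 tr2] := LS; elim: n => //= n IH abL abn ae.
have [aa bb ab] := abL n (leqnn _).
have fa : fib (a n) (transport a n e).
  by apply: transport_fib => // i /ltnW /abL[].
rewrite tr2 // ?abn // -IH //.
- by rewrite tr2 // abn.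
- by move=> i /ltnW /abL.
- by move=> i /leqW /abn.
Qed.

Lemma transport_ladder_ends (a b : nat -> X) (n : nat) (e : F) :
    (forall i, (i < n)%N -> [/\ (dist (a i) (a i.+1) <= L)%N,
      (dist (b i) (b i.+1) <= L)%N & (dist (a i) (b i.+1) <= L)%N]) ->
    (forall i, (i <= n)%N -> (dist (a i) (b i) <= L)%N) -> fib (a 0%N) e ->
    a 0%N = b 0%N -> a n = b n -> transport a n e = transport b n e.
Proof.
have [_ tr1 _] := LS; move=> abL abn ae ab0 abn'.
have := transport_ladder abL abn ae; rewrite -ab0 -abn' !tr1 //.
by apply: transport_fib => // i /abL[].
Qed.

Lemma transport_const (x : X) (a : nat -> X) (n : nat) (e : F) :
  (forall i, (i <= n)%N -> a i = x) -> fib x e -> transport a n e = e.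
Proof.
have [_ tr1 _] := LS; elim: n => //= n IH ax xe.
by rewrite IH ?ax // => [|i /leqW /ax //]; rewrite tr1.
Qed.

(** Staying at a vertex transports by the identity, so lingering [d] steps at each vertex changes
    nothing. *)
Lemma transport_slow (a : nat -> X) (d n : nat) (e : F) : (0 < d)%N ->
    (forall i, (i < n)%N -> (dist (a (i %/ d)%N) (a (i.+1 %/ d)%N) <= L)%N) ->
    fib (a 0%N) e ->
  transport (fun i => a (i %/ d)%N) n e = transport a (n %/ d) e.
Proof.
have [_ tr1 _] := LS; move=> d0; elim: n => [|n IH] aL ae /=; first by rewrite div0n.
have fa : fib (a (n %/ d)%N) (transport (fun i => a (i %/ d)%N) n e).
  apply: (@transport_fib (fun i => a (i %/ d)%N)); rewrite ?div0n //.
  by move=> i /ltnW; exact: aL.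
have IH' : transport (fun i => a (i %/ d)%N) n e = transport a (n %/ d) e.
  by apply: IH => // i /ltnW; exact: aL.
rewrite divnS //; case: (d %| n.+1)%N; rewrite ?add1n ?add0n /=.
  by rewrite IH'.
by rewrite tr1 // IH'.
Qed.

Lemma walk_transport_rcons (x y : X) (p : seq X) (e : F) :
  walk_transport x (rcons p y) e = tr (last x p) y (walk_transport x p e).
Proof. by elim: p x e => //= z p IH x e; rewrite IH. Qed.

Lemma transport_walk (x : X) (p : seq X) (e : F) :
  transport (nth x (x :: p)) (size p) e = walk_transport x p e.
Proof.
elim/last_ind: p => //= p z IH; rewrite size_rcons walk_transport_rcons -IH.
have nthE i : (i <= size p)%N -> nth x (x :: rcons p z) i = nth x (x :: p) i.
  by move=> ip; rewrite -rcons_cons nth_rcons /= ltnS ip.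
have E : transport (nth x (x :: rcons p z)) (size p) e = transport (nth x (x :: p)) (size p) e.
  elim: (size p) nthE => //= n IHn nthE.
  congr (tr _ _ _); [exact: nthE|exact: nthE (leqnn _)|].
  by apply: IHn => i /leqW; exact: nthE.
transitivity (tr (nth x (x :: rcons p z) (size p)) (nth x (x :: rcons p z) (size p).+1)
  (transport (nth x (x :: rcons p z)) (size p) e)); first by [].
rewrite E nthE //; congr (tr _ _ _); last by rewrite /= nth_rcons ltnn eqxx.
by rewrite -[nth _ _ _]/(nth x (x :: p) (size (x :: p)).-1) nth_last.
Qed.

End LocalSystems.

Section Monodromy.
Variables (K : realType) (X : graph) (k : nat).
Hypothesis X_sc : k_simply_connected K X k.
Variables (F : Type) (L : nat) (fib : X -> F -> Prop) (tr : X -> X -> F -> F).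
Hypotheses (kL : (k < L)%N) (LS : local_system L fib tr).

(** A null homotopy of the loop is sampled on a fine grid of labels. The bottom row shadows the
    walk, the top row stays at [x], and consecutive rows have the same transport. *)
Lemma walk_transport_closed (x : X) (p : seq X) (e : F) :
    path (@adj X) x p -> last x p = x -> fib x e ->
  walk_transport tr x p e = e.
Proof.
move=> pp pl xe; have [->//|p0] := eqVneq p [::].
set m := size p; have m0 : (0 < m)%N by rewrite lt0n size_eq0.
set xv : polygonal_complex K X k := complex_vertex K k x.
pose f (t : K) := walk_path k x p (m%:R * t).
have f0 : f 0 = xv by rewrite /f mulr0 walk_path0.
have f1 : f 1 = xv by rewrite /f mulr1 walk_path_size // pl.
have fpath : is_path f xv xv.
  split=> //; apply: continuous_subspaceT.
  have cm : continuous (fun t : K => m%:R * t).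
    by move=> t; apply: cvgM; [exact: cvg_cst|exact: cvg_id].
  move=> t; exact: (@continuous_comp _ _ _ (fun t : K => m%:R * t) (walk_path k x p) t
    (cm t) (@walk_path_continuous K X k x p pp _)).
have [_ _ /(_ f xv fpath)[H [cH Hbot Htop Hside]]] := X_sc.
have [n0 Hn0] := square_lebesgue_number cH (@open_complex_star K X k)
  (@complex_star_cover K X k).
(* Each of the [m] edges is cut into [d] pieces; the mesh [1/N] is then fine enough for the Lebesgue
   property of the pulled back star cover. *)
set d := n0.+1; set N := (m * d)%N.
have d0 : (0 < d)%N by [].
have N0 : (0 < N)%N by rewrite muln_gt0 m0.
have NK : 0 < N%:R :> K by rewrite ltr0n.
have n0N : (n0 <= N.-1)%N by rewrite -ltnS prednK // /N leq_pmull.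
pose pt (i : nat) : K := i%:R / N%:R.
have pt01 i : (i <= N)%N -> 0 <= pt i <= 1.
  by move=> iN; rewrite divr_ge0 ?ler0n //= ler_pdivrMr // mul1r ler_nat.
have pt0 : pt 0%N = 0 by rewrite /pt mul0r.
have ptN : pt N = 1 by rewrite /pt divff // gt_eqF.
(* Label each grid point by a vertex whose star contains the image of all points of the unit square
   within [1/N] of it in both coordinates. *)
have /choice[lab labP] : forall ij : nat * nat, exists y, (ij.1 <= N)%N -> (ij.2 <= N)%N ->
    forall z', (`[0, 1] `*` `[0, 1]) z' -> `|pt ij.1 - z'.1| <= N%:R^-1 ->
      `|pt ij.2 - z'.2| <= N%:R^-1 -> complex_star y (H z').
  move=> [i j] /=.
  have [[iN jN]|nij] := pselect ((i <= N)%N /\ (j <= N)%N); last first.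
    by exists x => iN jN; exfalso; apply: nij.
  have [|y yP] := Hn0 N.-1 n0N (pt i, pt j).
    by split; rewrite /= in_itv /= pt01.
  by exists y => _ _; rewrite prednK in yP.
have close (i i' : nat) : (i <= i'.+1)%N -> (i' <= i.+1)%N -> `|pt i - pt i'| <= N%:R^-1.
  move=> h1 h2; rewrite /pt -mulrBl normrM [X in _ * X]ger0_norm ?invr_ge0 ?ler0n //.
  rewrite ler_piMl ?invr_ge0 ?ler0n // ler_norml.
  have : i%:R <= i'.+1%:R :> K by rewrite ler_nat.
  have : i'%:R <= i.+1%:R :> K by rewrite ler_nat.
  by rewrite -!natr1 => a b; apply/andP; split; lra.
have star i j i' j' : (i <= N)%N -> (j <= N)%N -> (i' <= N)%N -> (j' <= N)%N ->
    (i <= i'.+1)%N -> (i' <= i.+1)%N -> (j <= j'.+1)%N -> (j' <= j.+1)%N ->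
    complex_star (lab (i, j)) (H (pt i', pt j')).
  move=> iN jN iN' jN' ? ? ? ?; apply: labP => //=; try exact: close.
  by split; rewrite /= in_itv /= pt01.
have labL i j i' j' : (i <= N)%N -> (j <= N)%N -> (i' <= N)%N -> (j' <= N)%N ->
    (i <= i'.+1)%N -> (i' <= i.+1)%N -> (j <= j'.+1)%N -> (j' <= j.+1)%N ->
    (dist (lab (i, j)) (lab (i', j')) <= L)%N.
  move=> iN jN iN' jN' ? ? ? ?; apply: leq_trans kL.
  (* Both stars contain the image of the grid point with indices [i'] and [j']. *)
  apply: (@complex_star_dist K X k _ _ (H (pt i', pt j'))); exact: star.
(* The point [xv] is a vertex, which lies in no star but its own; hence the two sides and the top
   carry the label [x]. *)
have starx i j : (i <= N)%N -> (j <= N)%N -> H (pt i, pt j) = xv -> lab (i, j) = x.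
  move=> iN jN Hx; apply/esym/(@complex_star_vertex K X k).
  by rewrite -/xv -Hx; apply: star.
have side0 j : (j <= N)%N -> lab (0%N, j) = x.
  by move=> jN; apply: starx => //; rewrite pt0 -f0; apply: (Hside _ (pt01 _ jN)).1.
have sideN j : (j <= N)%N -> lab (N, j) = x.
  by move=> jN; apply: starx => //; rewrite ptN -f0; apply: (Hside _ (pt01 _ jN)).2.
pose row j := transport tr (fun i => lab (i, j)) N e.
have rowS j : (j < N)%N -> row j = row j.+1.
  move=> jN; apply: (transport_ladder_ends LS); rewrite ?side0 ?sideN //; try lia.
    by move=> i iN; split; apply: labL; lia.
  by move=> i iN; apply: labL; lia.
have rowN : row N = e.
  apply: (transport_const LS (x := x)) => // i iN; apply: starx => //.
  by rewrite ptN -f0; apply: Htop; exact: pt01.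
have row0 : row 0%N = e.
  suff rowj j : (j <= N)%N -> row 0%N = row j by rewrite (rowj N).
  elim: j => [_|j IH jN]; first reflexivity.
  exact: etrans (IH (ltnW jN)) (rowS j jN).
pose w := nth x (x :: p).
have wadj j : (j < m)%N -> adj (w j) (w j.+1) by exact: (pathP x pp).
(* Along the bottom, [H] runs through the edge from [w (i %/ d)] to the next vertex of the walk, so
   nearby labels are ends of that edge. *)
have bot i i' : (i < N)%N -> (i' <= N)%N -> (i <= i'.+1)%N -> (i' <= i.+1)%N ->
    (dist (w (i %/ d)%N) (lab (i', 0%N)) <= 1)%N.
  move=> iN iN' ? ?.
  have jm : (i %/ d < m)%N by rewrite ltn_divLR.
  have := star i' 0%N i 0%N iN' isT (ltnW iN) isT; rewrite pt0 Hbot ?pt01 ?(ltnW iN) //.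
  have -> : f (pt i) = walk_path k x p (i%:R / d%:R).
    by rewrite /f /pt /N natrM mulrCA invfM mulVKf // pnatr_eq0 -lt0n.
  move=> st; have [] := @walk_path_star K X k x _ p (i %/ d) _ pp jm _ (st _ _ isT isT) => //.
  - have dK : 0 < d%:R :> K by rewrite ltr0n.
    rewrite ler_pdivlMr // -natrM ler_nat leq_trunc_div //=.
    by rewrite ler_pdivrMr // -natrM ler_nat ltnW // ltn_ceil.
  - by move=> ->; rewrite distxx.
  - by move=> ->; rewrite (dist_adj (wadj _ jm)).
have L1 : (1 <= L)%N by apply: leq_trans kL.
have wstep i : (i < N)%N -> (dist (w (i %/ d)%N) (w (i.+1 %/ d)%N) <= L)%N.
  move=> iN; have jm : (i %/ d < m)%N by rewrite ltn_divLR.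
  rewrite divnS //; case: (d %| i.+1)%N; rewrite ?add0n ?distxx //.
  by rewrite add1n (dist_adj (wadj _ jm)).
have wm : w m = x by rewrite /w -[RHS]pl (last_nth x).
have Nd : (N %/ d = m)%N by rewrite mulnK.
(* The walk is slowed down to [N] steps and compared with the bottom row by a ladder. *)
rewrite -transport_walk -/w -/m -Nd -(transport_slow LS) //.
rewrite -[RHS]row0; apply: (transport_ladder_ends LS).
- move=> i iN; split; first exact: wstep.
    by apply: labL; lia.
  by apply: leq_trans L1; apply: bot; lia.
- move=> i; rewrite leq_eqVlt => /orP[/eqP->|iN].
    by rewrite Nd wm sideN // distxx.
  by apply: leq_trans L1; apply: bot; lia.
- by rewrite div0n.
- by rewrite div0n side0.
- by rewrite Nd wm sideN.
Qed.

End Monodromy.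

(** * Path independence and global sections *)

Section Sections.
Variables (K : realType) (X : graph) (k : nat).
Hypothesis X_sc : k_simply_connected K X k.
Variables (F : Type) (L : nat) (fib : X -> F -> Prop) (tr : X -> X -> F -> F).
Hypotheses (kL : (k < L)%N) (LS : local_system L fib tr).

Lemma walk_transport_fib (x : X) (p : seq X) (e : F) :
  path (@adj X) x p -> fib x e -> fib (last x p) (walk_transport tr x p e).
Proof.
have [trF _ _] := LS; elim: p x e => //= y p IH x e /andP[xy pp] xe.
by apply: IH => //; apply: trF => //; rewrite (dist_adj xy) (leq_trans _ kL).
Qed.

Lemma walk_transport_cat (x : X) (p q : seq X) (e : F) :
  walk_transport tr x (p ++ q) e = walk_transport tr (last x p) q (walk_transport tr x p e).
Proof. by elim: p x e => //= y p IH x e; rewrite IH. Qed.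

Lemma walk_transport_rev (x : X) (p : seq X) : path (@adj X) x p ->
  exists q, [/\ path (@adj X) (last x p) q, last (last x p) q = x,
    forall e, fib x e -> walk_transport tr (last x p) q (walk_transport tr x p e) = e &
    forall e, fib (last x p) e -> walk_transport tr x p (walk_transport tr (last x p) q e) = e].
Proof.
have [trF tr1 tr2] := LS.
have L1 : (1 <= L)%N by apply: leq_trans kL.
elim: p x => [|y p IH] x /=; first by exists [::].
move=> /andP[xy pp]; have [q [qp ql pq qp']] := IH y pp.
have yx : adj y x by rewrite adj_sym.
have trK u v e : adj u v -> fib u e -> tr v u (tr u v e) = e.
  by move=> uv ue; rewrite tr2 ?distxx ?(dist_adj uv) ?tr1 // dist_sym (dist_adj uv).
exists (rcons q x); split.
- by rewrite rcons_path qp ql.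
- by rewrite last_rcons.
- move=> e xe; rewrite walk_transport_rcons ql pq ?trK //.
  by apply: trF; rewrite ?(dist_adj xy).
- move=> e ye; rewrite walk_transport_rcons ql trK ?qp' //.
  by rewrite -[X in fib X]ql; exact: walk_transport_fib.
Qed.

(** Following [p] and then the reverse of [q] is a closed walk, whose transport is trivial. *)
Lemma walk_transport_unique (x : X) (p q : seq X) (e : F) :
    path (@adj X) x p -> path (@adj X) x q -> last x p = last x q -> fib x e ->
  walk_transport tr x p e = walk_transport tr x q e.
Proof.
move=> pp qp pq xe; have [r [rp rl _ rK]] := walk_transport_rev qp.
have fp : fib (last x q) (walk_transport tr x p e).
  by rewrite -pq; exact: walk_transport_fib.
have cl : walk_transport tr x (p ++ r) e = e.
  apply: (walk_transport_closed X_sc kL LS) => //; first by rewrite cat_path pp pq.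
  by rewrite last_cat pq.
by rewrite walk_transport_cat pq in cl; rewrite -(rK _ fp) cl.
Qed.

(** Transport [e] to each [y] along a chosen walk; path independence compares the walk to [y],
    extended by an edge to [z], with the one chosen for [z]. *)
Lemma local_system_section (x : X) (e : F) : fib x e ->
  exists s : X -> F, [/\ s x = e, forall y, fib y (s y) &
    forall y z, adj y z -> tr y z (s y) = s z].
Proof.
move=> xe.
have /choice[P PP] : forall y, exists p, path (@adj X) x p /\ last x p = y.
  by move=> y; have [p pp pl] := adj_connected x y; exists p.
exists (fun y => walk_transport tr x (P y) e); split.
- by have [pp pl] := PP x; exact: (walk_transport_closed X_sc kL LS).
- by move=> y; have [pp pl] := PP y; rewrite -{1}pl; exact: walk_transport_fib.
- move=> y z yz; have [py ly] := PP y; have [pz lz] := PP z.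
  rewrite -{1}ly -walk_transport_rcons; apply: walk_transport_unique => //.
    by rewrite rcons_path py ly.
  by rewrite last_rcons.
Qed.

End Sections.

(** * Ultralimits of local isomorphisms *)

Section Ultralimits.
Local Open Scope nat_scope.

Lemma ultra_nat : exists U : set_system nat,
  UltraFilter U /\ forall n, U [set m | n <= m].
Proof.
have [U [UU sub]] := @ultraFilterLemma nat \oo _.
by exists U; split=> // n; apply: sub; exists n.
Qed.

Lemma proper_filter_meet (I : Type) (F : set_system I) (A B C : set I) :
  ProperFilter F -> F A -> F B -> F C -> exists i, [/\ A i, B i & C i].
Proof.
move=> FF FA FB FC; have [i [[Ai Bi] Ci]] := filter_ex (filterI (filterI FA FB) FC).
by exists i.
Qed.

Lemma filter_finite (I : Type) (F : set_system I) (T : choiceType) (A : set T)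
    (P : T -> set I) : Filter F -> finite_set A -> (forall v, A v -> F (P v)) ->
  F [set i | forall v, A v -> P v i].
Proof.
move=> FF /finite_seqP[s ->]; elim: s => [|v s IH] FP.
  by apply: (@filterS _ F FF _ _ _ filterT) => i _ v.
have H := @filterI _ F FF _ _ (FP v (mem_head _ _))
  (IH (fun w ws => FP w (mem_behead (s := v :: s) ws))).
apply: (@filterS _ F FF _ _ _ H) => i [Pv Ps] w; rewrite /= inE => /orP[/eqP->//|]; exact: Ps.
Qed.

(** Otherwise [U] contains the complement of every fibre over [A], hence their finite intersection,
    on which [a] avoids [A]. *)
Lemma ultra_finite (I : Type) (U : set_system I) (T : choiceType) (A : set T)
    (a : I -> T) : UltraFilter U -> finite_set A -> U [set i | A (a i)] ->
  exists v, A v /\ U [set i | a i = v].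
Proof.
move=> UU fA UA; apply: contrapT => no.
have FU : Filter U by case: (ultra_proper (F := U)).
have : U [set i | forall v, A v -> (~` [set j | a j = v]) i].
  apply: (@filter_finite _ U _ A (fun v => ~` [set j | a j = v])) => // v Av.
  have [Uv|//] := in_ultra_setVsetC [set j | a j = v] UU.
  by exfalso; apply: no; exists v.
move=> UC; have [i [Ai /(_ _ Ai) /= ne _]] :=
  proper_filter_meet (ultra_proper (F := U)) UA UC UC.
exact: ne.
Qed.

Variable X : graph.

Lemma cocompact_reps : cocompact X -> exists A : set X,
  finite_set A /\ forall x, exists phi, Isom phi /\ A (phi x).
Proof.
move=> fin; have [x0] := graph_nonempty X.
exists (xget x0 @` range (@Isom_orbit X)); split; first exact: finite_image.
move=> x; have : Isom_orbit x (xget x0 (Isom_orbit x)).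
  by apply: (@xgetPex _ x0); exists x; exists id => //; exact: Isom_id.
by move=> [phi phiI phix]; exists phi; split=> //; rewrite phix; exists (Isom_orbit x).
Qed.

Hypothesis X_cocompact : cocompact X.

(** If no radius works, every [n] has a nontrivial isometry fixing an n-ball. Conjugation moves the
    centres into the finite set [A]; along an ultrafilter the centre and, by finiteness of its
    stabilizer, the isometry become constant. The constant value fixes every ball, so it is the
    identity, a contradiction. *)
Lemma Isom_determined : (forall x : X, finite_set (Isom_stabilizer x)) ->
  exists r, forall (x : X) phi, Isom phi ->
    (forall u, dist x u <= r -> phi u = u) -> forall u, phi u = u.
Proof.
move=> fin; have [A [fA AP]] := cocompact_reps X_cocompact.
apply: contrapT => no.
have /choice[a aP] : forall n, exists y_phi : X * (X -> X),
    [/\ A y_phi.1, Isom y_phi.2, forall u, dist y_phi.1 u <= n -> y_phi.2 u = u &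
        exists u, y_phi.2 u <> u].
  move=> n; apply: contrapT => no'; apply: no; exists n => x phi phiI fixes.
  apply: contrapT => nid; apply: no'.
  have [psi [psiI Apsi]] := AP x; have [psi' [psi'I psiK psiK']] := Isom_inv psiI.
  exists (psi x, psi \o phi \o psi'); split=> //=.
  - by apply: Isom_comp => //; exact: Isom_comp.
  - move=> u un; rewrite fixes ?psiK' //.
    by have [_ <-] := psiI; rewrite psiK'.
  - apply: contrapT => nu; apply: nid => u; apply: contrapT => phiu.
    by apply: nu; exists (psi u) => /=; rewrite psiK => /(can_inj psiK).
have [U [UU Uoo]] := ultra_nat.
have FU : ProperFilter U by exact: ultra_proper.
have [y [Ay Uy]] : exists y, A y /\ U [set n | (a n).1 = y].
  by apply: ultra_finite => //; apply: filterS filterT => n _; case: (aP n).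
have [phi [_ Uphi]] : exists phi, Isom_stabilizer y phi /\ U [set n | (a n).2 = phi].
  apply: ultra_finite => //; apply: filterS Uy => n /= ny; have [_ ? f _] := aP n.
  by split=> //; rewrite f // ny distxx.
have phi1 u : phi u = u.
  have [n /= [<- ny dn]] := proper_filter_meet FU Uphi Uy (Uoo (dist y u)).
  by have [_ _ f _] := aP n; rewrite f // ny.
have [n /= np] := filter_ex Uphi.
by have [_ _ _ [u]] := aP n; rewrite np phi1.
Qed.

(** Non-extendable local isomorphisms of every radius [n], moved so that both centres lie in the
    finite set [A], converge pointwise along an ultrafilter to a global isometry, which agrees with
    one of them on the finite s-ball. *)
Lemma Isom_extend (s : nat) : exists S, s <= S /\
  forall (x : X) (f : X -> X), local_iso S x f ->
    exists alpha, Isom alpha /\ forall u, dist x u <= s -> f u = alpha u.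
Proof.
have [A [fA AP]] := cocompact_reps X_cocompact.
apply: contrapT => no.
have /choice[a aP] : forall n, exists y_f : X * (X -> X),
    [/\ A y_f.1, A (y_f.2 y_f.1), local_iso n y_f.1 y_f.2 &
        ~ exists alpha, Isom alpha /\ forall u, dist y_f.1 u <= s -> y_f.2 u = alpha u].
  move=> n; apply: contrapT => no'; apply: no; exists (maxn s n).
  split; first exact: leq_maxl.
  move=> x f /(local_iso_le (leq_maxr s n)) fi.
  apply: contrapT => next; apply: no'.
  have [psi [psiI Apsi]] := AP x; have [psi' [psi'I psiK psiK']] := Isom_inv psiI.
  have [chi [chiI Achi]] := AP (f x); have [chi' [chi'I chiK chiK']] := Isom_inv chiI.
  exists (psi x, chi \o f \o psi'); split=> //=.
  - by rewrite psiK.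
  - apply: (@local_iso_comp _ X _ _ _ psi' (chi \o f)).
      exact: Isom_local_iso.
    rewrite psiK; apply: local_iso_comp => //; exact: Isom_local_iso.
  - move=> [alpha [alphaI fa]]; apply: next.
    exists (chi' \o alpha \o psi); split.
      by apply: Isom_comp => //; exact: Isom_comp.
    move=> u us /=; rewrite -fa ?psiK ?chiK //.
    by have [_ ->] := psiI.
have [U [UU Uoo]] := ultra_nat.
have FU : ProperFilter U by exact: ultra_proper.
have [y [Ay Uy]] : exists y, A y /\ U [set n | (a n).1 = y].
  by apply: ultra_finite => //; apply: filterS filterT => n _; case: (aP n).
have [z [Az Uz]] : exists z, A z /\ U [set n | (a n).2 (a n).1 = z].
  by apply: ultra_finite => //; apply: filterS filterT => n _; case: (aP n).
have Ugood d : U [set n | [/\ (a n).1 = y, (a n).2 y = z & local_iso d y (a n).2]].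
  apply: filterS (filterI (filterI Uy Uz) (Uoo d)) => n /= [[ny nz] dn].
  have [_ _ li _] := aP n; rewrite -ny; split=> //; exact: local_iso_le li.
(* The images of [u] stay in a fixed ball about [z], which is finite, so the limit exists. *)
have /choice[f Uf] : forall u, exists v, U [set n | (a n).2 u = v].
  move=> u; have [|v [_ Uv]] := @ultra_finite _ U _ [set v | dist z v <= dist y u]
    (fun n => (a n).2 u) UU (finite_ball _ _); last by exists v.
  apply: filterS (Ugood (dist y u)) => n /= [_ nz [_ dst _ _]].
  by rewrite -nz dst.
have fdist u v : dist (f u) (f v) = dist u v.
  have [n /= [<- <- [_ _ li]]] :=
    proper_filter_meet FU (Uf u) (Uf v) (Ugood (dist y u + dist u v)).
  exact: (local_iso_dist li).
have finj : injective f.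
  by move=> u v uv; apply: dist_eq0; rewrite -fdist uv distxx.
have fsurj v : exists u, f u = v.
  (* Preimages of [v] also stay in a fixed finite ball, so they are constant along [U]. *)
  pose b n := xget y [set u | dist y u <= dist z v /\ (a n).2 u = v].
  have Ub : U [set n | dist y (b n) <= dist z v /\ (a n).2 (b n) = v].
    apply: filterS (Ugood (dist z v)) => n /= [_ nz [_ _ sur _]].
    have [|u un uv] := sur v; first by rewrite nz.
    exact: (@xgetPex _ y [set u | dist y u <= dist z v /\ (a n).2 u = v]
      (ex_intro _ u (conj un uv))).
  have [|u [_ Uu]] := @ultra_finite _ U _ [set u | dist y u <= dist z v] b UU
    (finite_ball _ _); first by apply: filterS Ub => n [].
  have [n /= [nu [_ nv] nf]] := proper_filter_meet FU Uu Ub (Uf u).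
  by exists u; rewrite -nf -nu.
have fI : Isom f.
  split=> //; have [g gP] := choice fsurj.
  by exists g => // u; apply: finj; rewrite gP.
have Us : U [set n | forall u, [set u | dist y u <= s] u -> [set n | (a n).2 u = f u] n].
  apply: (@filter_finite _ U _ _ (fun u => [set n | (a n).2 u = f u])) => //.
  exact: finite_ball.
have [n /= [[ny _ _] nf _]] := proper_filter_meet FU (Ugood 0) Us Us.
have [_ _ _] := aP n; apply; exists f; split=> // u; rewrite ny; exact: nf.
Qed.

End Ultralimits.

(** * Ball isometries and coverings *)

Section BallIsometries.
Variables (K : realType).

Lemma graph_ball_nat (X : graph) (n : nat) (x u : X) :
  graph_ball x (n%:R : K) u <-> (dist x u <= n)%N.
Proof. by rewrite /graph_ball /= ler_nat. Qed.

Lemma ball_adj_nat (X : graph) (n : nat) (x u v : X) :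
  ball_adj x (n%:R : K) u v = adj u v && (dist x u + dist x v < n.*2)%N.
Proof.
by rewrite /ball_adj ler_pdivrMr // -natrM ler_nat muln2.
Qed.

(** Edges of a geodesic from the centre join consecutive distance levels, so all of them lie in the
    closed ball. *)
Lemma ball_dist_center (X : graph) (n : nat) (x u : X) : (dist x u <= n)%N ->
  ball_dist x (n%:R : K) x u = dist x u.
Proof.
move=> un.
have [p [pp pl ps]] : exists p,
    [/\ path (ball_adj x (n%:R : K)) x p, last x p = u & size p = dist x u].
  move: {2}(dist x u) (erefl (dist x u)) un => m.
  elim: m u => [|m IH] u um un; first by exists [::]; rewrite um (dist_eq0 um).
  have [v vu vm] := dist_step um.
  have vn : (dist x v <= n)%N by rewrite vm; rewrite um in un; exact: ltnW.
  have [p [pp pl ps]] := IH v vm vn.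
  exists (rcons p u); split; rewrite ?last_rcons // ?size_rcons ?ps ?vm ?um //.
  rewrite rcons_path pp pl ball_adj_nat vu vm um /=; rewrite um in un; lia.
have [[q [qp ql] qs] minq] := @walk_dist_ex _ (ball_adj x (n%:R : K)) x u
  (ex_intro _ p (conj pp pl)).
apply/eqP; rewrite eqn_leq -{1}ps minq //= /ball_dist -qs -{1}ql.
by apply: dist_le_size; apply: sub_path qp => a b /andP[].
Qed.

(** One unit of radius is lost: edges between two vertices at distance [n.+1] are missing from the
    larger ball, whereas on the n-ball adjacency is the same as intrinsic distance 1. *)
Lemma ball_isometry_local_iso (X Y : graph) (n : nat) (x : X) (y : Y) (f : X -> Y) :
  ball_isometry (n.+1%:R : K) x y f -> local_iso n x f.
Proof.
move=> [fx [fB finj fsurj] fd]; rewrite -fx in fB fsurj fd *.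
have fdist u : (dist x u <= n.+1)%N -> dist (f x) (f u) = dist x u.
  move=> un; have /graph_ball_nat uB := un; have /graph_ball_nat fun_ := fB _ uB.
  rewrite -(ball_dist_center fun_) fd ?ball_dist_center //.
  by apply/graph_ball_nat; rewrite distxx.
have irr (Z : graph) (z : Z) : irreflexive (ball_adj z (n.+1%:R : K)).
  by move=> u; rewrite /ball_adj adj_irr.
have adjE (Z : graph) (z u v : Z) : (dist z u <= n)%N -> (dist z v <= n)%N ->
    adj u v = ball_adj z (n.+1%:R : K) u v.
  by move=> un vn; rewrite ball_adj_nat; case: adj => //=; apply/esym; lia.
split.
- move=> u v un vn; apply: finj; apply/mem_set/graph_ball_nat; exact: leqW.
- by move=> u un; apply: fdist; exact: leqW.
- move=> v vn; have /graph_ball_nat vB := leqW vn.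
  have [u /graph_ball_nat un uv] := fsurj _ vB.
  by exists u => //; rewrite -fdist // uv.
- move=> u v un vn; rewrite (adjE _ x) // (adjE _ (f x)) ?fdist ?leqW //.
  have uB : graph_ball x (n.+1%:R : K) u by apply/graph_ball_nat; exact: leqW.
  have vB : graph_ball x (n.+1%:R : K) v by apply/graph_ball_nat; exact: leqW.
  have e : walk_dist (ball_adj (f x) (n.+1%:R : K)) (f u) (f v) =
    walk_dist (ball_adj x (n.+1%:R : K)) u v := fd u v uB vB.
  by apply/idP/idP => /(walk_dist_eq1 _ _ (irr _ _)) h;
    apply/(walk_dist_eq1 _ _ (irr _ _)); rewrite -h e.
Qed.

Lemma Isom_ball_isometry (X : graph) (R : K) (x : X) (phi : X -> X) :
  Isom phi -> ball_isometry R x (phi x) phi.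
Proof.
move=> phiI; have [psi [psiI phiK psiK]] := Isom_inv phiI.
have sub (chi : X -> X) z u v : Isom chi ->
    walk_lengths (ball_adj z R) u v `<=` walk_lengths (ball_adj (chi z) R) (chi u) (chi v).
  move=> chiI m [p [pp <-] <-]; have [_ chid] := chiI.
  exists (map chi p); rewrite ?size_map //.
  split; last by rewrite last_map.
  rewrite path_map; apply: sub_path pp => a b.
  by rewrite /ball_adj /= Isom_adj // !chid.
have [_ phid] := phiI.
split=> //; first split.
- by move=> u; rewrite /graph_ball /= phid.
- by move=> u v _ _ /(can_inj phiK).
- move=> v; rewrite /graph_ball /= -{1}(psiK v) phid => vR.
  by exists (psi v).
- move=> u v _ _; rewrite /ball_dist /walk_dist.
  suff -> : walk_lengths (ball_adj (phi x) R) (phi u) (phi v) =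
    walk_lengths (ball_adj x R) u v by [].
  apply/seteqP; split; last exact: sub.
  by have := @sub psi (phi x) (phi u) (phi v) psiI; rewrite !phiK.
Qed.

Lemma Isom_covering (X : graph) (phi : X -> X) : Isom phi -> graph_covering phi.
Proof.
move=> phiI; have [psi [psiI phiK psiK]] := Isom_inv phiI; split.
- by move=> y; exists (psi y).
- by move=> u v; rewrite Isom_adj.
- move=> x; split.
  + by move=> u; rewrite /= Isom_adj.
  + by move=> u v _ _ /(can_inj phiK).
  + by move=> v /=; rewrite -{1}(psiK v) Isom_adj // => h; exists (psi v).
Qed.

(** Stabilizer elements are coverings of [X] by itself, so uniqueness makes the r-ball determine
    them. As this ball is finite and its vertices have finitely many possible images, an infinite
    stabilizer would contain two different elements agreeing on it. *)
Lemma rigid_stabilizer_finite (X : graph) (x : X) :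
  USLG_rigid K X -> finite_set (Isom_stabilizer x).
Proof.
move=> [r _ /(_ r (lexx r))[R _ rig]]; apply: contrapT => inf.
have loc : R_locally X R X by move=> y; exists y, id; exact/Isom_ball_isometry/Isom_id.
have eq_ball phi psi : Isom_stabilizer x phi -> Isom_stabilizer x psi ->
    (forall u, graph_ball x r u -> phi u = psi u) -> phi = psi.
  move=> [phiI phix] [psiI psix] e.
  have psib : ball_isometry R x x psi.
    by have := Isom_ball_isometry R x psiI; rewrite psix.
  have [h [_ huniq]] := rig X loc x x psi psib.
  have <- := huniq psi (conj (Isom_covering psiI) (fun u _ => erefl)).
  by apply/esym/huniq; split=> //; exact: Isom_covering.
have fball : finite_set (graph_ball x r).
  apply: sub_finite_set (finite_ball x (Num.truncn r)) => u; rewrite /graph_ball /= => ur.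
  by rewrite truncn_ge_nat // (le_trans _ ur).
have [a [aS ainj]] : exists a : nat -> X -> X, (forall n, Isom_stabilizer x (a n)) /\ injective a.
  move/infiniteP/card_leP : inf => [f].
  pose g n : set_type [set: nat] := exist (fun m => m \in [set: nat]) n (mem_set I).
  exists (fun n => \val (f (g n))); split=> [n|m n /val_inj fmn].
    exact: (set_valP (f (g n))).
  have /(congr1 val) // : g m = g n by apply: (inj (f := f)); rewrite ?in_setT.
have [U [UU Uoo]] := ultra_nat.
have FU : ProperFilter U by exact: ultra_proper.
have /choice[b Ub] : forall u, exists v, U [set n | a n u = v].
  move=> u; have [|v [_ Uv]] := @ultra_finite _ U _ [set v | (dist x v <= dist x u)%N]
    (fun n => a n u) UU (finite_ball _ _); last by exists v.
  apply: filterS filterT => n _ /=; have [[_ ad] ax] := aS n.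
  by rewrite -{1}ax ad.
(* The limit [b] is attained on the whole r-ball for a set of indices in [U], which therefore
   contains two indices [m < n]. *)
have Us : U [set n | forall u, graph_ball x r u -> [set n | a n u = b u] n].
  exact: (@filter_finite _ U _ _ (fun u => [set n | a n u = b u])).
have [m [Hm _ _]] := proper_filter_meet FU Us Us Us.
have [n [Hn mn _]] := proper_filter_meet FU Us (Uoo m.+1) Us.
have := ainj m n (eq_ball _ _ (aS m) (aS n) _); rewrite /= in mn => e.
suff : m = n by move=> mne; rewrite mne ltnn in mn.
by apply: e => u ur; rewrite Hm ?Hn.
Qed.
End BallIsometries.

(** * Coverings are local isomorphisms at a uniform scale *)

Section Coverings.
Local Open Scope nat_scope.

(** If [u] and [v] were distinct with the same image, [A] without [u] would still map onto [B],
    which is too large for that. *)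
Lemma finite_surj_inj (T U : choiceType) (A : set T) (B : set U) (f : T -> U) :
    finite_set A -> f @` A = B -> #|` fset_set A| <= #|` fset_set B| ->
  forall u v, A u -> A v -> f u = f v -> u = v.
Proof.
move=> fA fAB AB u v Au Av fuv; apply: contrapT => uv.
have fAu : finite_set (A `\ u) by exact: finite_setD.
have BE : B = f @` (A `\ u).
  apply/seteqP; split=> b; rewrite -fAB => -[a].
    move=> Aa <-; have [->|au] := pselect (a = u); last by exists a.
    by exists v => //; split=> // /esym.
  by move=> [Aa _] <-; exists a.
have : #|` fset_set B| <= #|` fset_set (A `\ u)|.
  by rewrite BE fset_set_image //; exact: leq_imfset_card.
move=> /(leq_trans AB); rewrite fset_setD1 // (cardfsD1 u (fset_set A)).
by rewrite in_fset_set // mem_set // add1n ltnn.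
Qed.

Definition ball_size (X : graph) (n : nat) (x : X) : nat :=
  #|` fset_set [set u | dist x u <= n]|.

Lemma local_iso_ball_image (X Y : graph) n (x : X) (f : X -> Y) : local_iso n x f ->
  f @` [set u | dist x u <= n] = [set v | dist (f x) v <= n].
Proof.
move=> [_ dst sur _]; apply/seteqP; split=> v /=.
  by move=> [u un <-]; rewrite dst.
by move=> /sur[u un uv]; exists u.
Qed.

Lemma local_iso_ball_size (X Y : graph) n (x : X) (f : X -> Y) :
  local_iso n x f -> ball_size n (f x) = ball_size n x.
Proof.
move=> fi; have [inj _ _ _] := fi.
rewrite /ball_size -(local_iso_ball_image fi) fset_set_image; last exact: finite_ball.
rewrite card_in_imfset //= => u v; rewrite !in_fset_set; try exact: finite_ball.
by move=> /set_mem un /set_mem vn; exact: inj.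
Qed.

Section Covering.
Variables (X Y : graph) (phi : X -> Y).
Hypothesis phi_cov : graph_covering phi.

Lemma covering_dist_le (u v : X) : dist (phi u) (phi v) <= dist u v.
Proof.
have [_ hom _] := phi_cov.
have [p [pp <-] <-] := dist_path u v.
rewrite -last_map -(size_map phi p); apply: dist_le_size.
by rewrite path_map; apply: sub_path pp => a b; exact: hom.
Qed.

(** A geodesic lifts edge by edge. *)
Lemma covering_lift (x : X) (v : Y) :
  exists2 u, phi u = v & dist x u <= dist (phi x) v.
Proof.
have [_ _ bij] := phi_cov.
have [p [pp <-] <-] := dist_path (phi x) v.
elim/last_ind: p pp => [|p z IH]; first by exists x => //; rewrite distxx.
rewrite rcons_path last_rcons size_rcons => /andP[pp pz].
have [u uE ud] := IH pp; have [_ _ sur] := bij u.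
have [|w uw wz] := sur z; first by rewrite /= uE.
exists w => //; apply: leq_trans (dist_triangle_adj _ uw) _; exact: ud.
Qed.

Lemma covering_ball_image n (x : X) :
  phi @` [set u | dist x u <= n] = [set v | dist (phi x) v <= n].
Proof.
apply/seteqP; split=> v /=.
  by move=> [u un <-]; apply: leq_trans (covering_dist_le _ _) un.
by have [u <- xu] := covering_lift x v => un; exists u => //; exact: leq_trans un.
Qed.

(** Injectivity is assumed one step beyond [n], since the lift of an edge starting in the n-ball may
    end at distance [n.+1]. *)
Lemma covering_local_iso n (x : X) :
    (forall u v, dist x u <= n.+1 -> dist x v <= n.+1 -> phi u = phi v -> u = v) ->
  local_iso n x phi.
Proof.
move=> inj; have [_ hom bij] := phi_cov; split.
- by move=> u v un vn; apply: inj; exact: leqW.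
- move=> u un; apply/eqP; rewrite eqn_leq covering_dist_le /=.
  have [w wu xw] := covering_lift x (phi u).
  suff <- : w = u by rewrite wu.
  apply: inj => //; last exact: leqW.
  by apply: leqW; apply: leq_trans xw (leq_trans (covering_dist_le _ _) un).
- move=> v; have [u <- xu] := covering_lift x v => un.
  by exists u => //; exact: leq_trans un.
- move=> u v un vn; apply/idP/idP => [uv|]; last exact: hom.
  have [_ _ sur] := bij u; have [w uw wv] := sur _ uv.
  suff <- : w = v by [].
  apply: inj => //; last exact: leqW.
  by apply: leq_trans (dist_triangle_adj _ uw) _.
Qed.

End Covering.

Lemma cocompact_dense (X : graph) : cocompact X -> exists D, forall x z : X,
  exists phi, Isom phi /\ dist x (phi z) <= D.
Proof.
move=> /cocompact_reps[A [/finite_seqP[s ->] AP]].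
exists (\max_(a <- s) \max_(b <- s) dist a b) => x z.
have [psi [psiI psix]] := AP x; have [chi [chiI chiz]] := AP z.
have [psi' [psi'I psiK psiK']] := Isom_inv psiI.
exists (psi' \o chi); split; first exact: Isom_comp.
have [_ psid] := psiI; rewrite -psid /= psiK'.
have Hb := leq_bigmax_seq (P := xpredT) (F := fun b => dist (psi x) b) _
  (chiz : _ \in s) isT.
have Ha := leq_bigmax_seq (P := xpredT) (F := fun a => \max_(b <- s) dist a b) _
  (psix : _ \in s) isT.
exact: leq_trans Hb Ha.
Qed.

(* A covering maps n-balls onto n-balls, and it is injective on an n-ball of
   minimal cardinality because all n-balls of Y are isomorphic to balls of X. *)
Lemma cocompact_covering_local_iso (X : graph) (s : nat) : cocompact X ->
  exists N, forall Y : graph,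
    (forall y : Y, exists x (g : X -> Y), local_iso N x g /\ g x = y) ->
    forall (phi : X -> Y), graph_covering phi -> forall x, local_iso s x phi.
Proof.
move=> /cocompact_dense[D DP]; exists (D + s.+1) => Y Yloc phi phi_cov x.
(* Here [D] reaches a translate of the smallest ball, and [s.+1] is the injectivity radius asked for
   by [covering_local_iso]. *)
set N := D + s.+1.
have [x0] := graph_nonempty X.
have ex : exists m, `[< exists z : X, ball_size N z = m >].
  by exists (ball_size N x0); apply/asboolP; exists x0.
case: (ex_minnP ex) => m /asboolP[z zm] minm.
have [alpha [alphaI xz]] := DP x z.
have azm : ball_size N (alpha z) = m.
  by rewrite -zm; apply: local_iso_ball_size; exact: Isom_local_iso.
apply: covering_local_iso => // u v un vn.
have [z' [g [gi gz]]] := Yloc (phi (alpha z)).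
(* The N-ball at the image has the size of some N-ball of [X], hence at least the minimum [m]. *)
have card : ball_size N (alpha z) <= ball_size N (phi (alpha z)).
  rewrite azm -gz (local_iso_ball_size gi); apply: minm.
  by apply/asboolP; exists z'.
have sub w : dist x w <= s.+1 -> dist (alpha z) w <= N.
  by have := dist_triangle x (alpha z) w; rewrite (dist_sym (alpha z) x) /N; lia.
apply: (finite_surj_inj (finite_ball (alpha z) N) (covering_ball_image phi_cov N (alpha z))).
- exact: card.
- exact: sub.
- exact: sub.
Qed.

End Coverings.

(** * Germs of local isomorphisms *)

Section Germs.
Local Open Scope nat_scope.
(** Germs live on r0-balls and determine local isomorphisms on s-balls, which allows moves by [L];
    radius [S] gives agreement with isometries on s-balls, and [N] leaves room for moves by [L] and
    by [r]. *)
Variables (X Y : graph) (r0 s S N L r : nat).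
Hypotheses (L_gt0 : 0 < L) (sE : s = r0 + L).
Hypothesis Isom_det : forall (x : X) phi, Isom phi ->
  (forall u, dist x u <= r0 -> phi u = u) -> forall u, phi u = u.
Hypothesis Isom_ext : forall (x : X) (f : X -> X), local_iso S x f ->
  exists alpha, Isom alpha /\ forall u, dist x u <= s -> f u = alpha u.
Hypothesis sS : s <= S.

(** On the s-ball, [h'] followed by the local inverse of [h] is the restriction of a global
    isometry; it fixes the r0-ball, so it is the identity. *)
Lemma local_iso_unique (x : X) (h h' : X -> Y) : local_iso S x h -> local_iso S x h' ->
    (forall u, dist x u <= r0 -> h u = h' u) ->
  forall u, dist x u <= s -> h u = h' u.
Proof.
move=> hi hi' hh'; have [g [gi gh hg]] := local_iso_inv hi.
have hx : h x = h' x by rewrite hh' // distxx.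
have [_ dst' _ _] := hi'.
have ghi : local_iso S x (g \o h') by apply: local_iso_comp => //; rewrite -hx.
have [alpha [alphaI aE]] := Isom_ext ghi.
have a1 : forall u, alpha u = u.
  apply: (Isom_det (x := x)) => // u un; rewrite -aE /=; last lia.
  by rewrite -hh' // gh //; lia.
move=> u us; have := aE u us; rewrite a1 /= => e; rewrite -{1}e hg //.
by rewrite hx dst'; lia.
Qed.

(** Agreement spreads along edges, because the r0-ball at a neighbour of [v] lies in the s-ball at
    [v]. *)
Lemma covering_unique (phi psi : X -> Y) (x : X) :
    (forall x, local_iso S x phi) -> (forall x, local_iso S x psi) ->
    (forall u, dist x u <= r0 -> phi u = psi u) ->
  phi = psi.
Proof.
move=> phii psii e; apply/funext => u.
suff : forall u v, dist u v <= r0 -> phi v = psi v by move/(_ u u); rewrite distxx; apply.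
apply: (@graph_ind _ _ x) => // v w vw IH z zr.
apply: (local_iso_unique (x := v)) => //.
by have := dist_triangle w v z; rewrite (dist_adj vw); lia.
Qed.

Hypothesis NLS : S + L + r < N.
Hypothesis Yloc : forall y : Y, exists x (g : X -> Y), local_iso N x g /\ g x = y.

(** Compare [h] with an N-scale chart [g] of [Y] at [h x]: the transition map agrees on the s-ball
    with a global isometry [alpha], and [g \o alpha] has radius [N]. *)
Lemma local_iso_grow (x : X) (h : X -> Y) : local_iso S x h ->
  exists h', local_iso N x h' /\ forall u, dist x u <= s -> h' u = h u.
Proof.
move=> hi; have [z [g [gi gz]]] := Yloc (h x).
have SN : S <= N by lia.
have [g' [gi' gg' g'g]] := local_iso_inv (local_iso_le SN gi).
rewrite gz in gi' g'g.
have [alpha [alphaI aE]] := Isom_ext (local_iso_comp hi gi').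
have [_ dst _ _] := hi.
have ax : alpha x = z.
  by rewrite -aE /= ?distxx // -gz gg' // distxx.
exists (g \o alpha); split.
  by apply: local_iso_comp; [exact: Isom_local_iso|rewrite ax].
by move=> u us; rewrite /= -aE //= g'g // dst //; lia.
Qed.

(* Outside the ball of radius r0 a germ takes a dummy value which depends only
   on its restriction to that ball. *)
Definition germ (x : X) (h : X -> Y) : X -> Y :=
  fun u => if dist x u <= r0 then h u else h x.

Lemma germ_eq (x : X) (h h' : X -> Y) :
  germ x h = germ x h' <-> forall u, dist x u <= r0 -> h u = h' u.
Proof.
split=> [e u un|e].
  by have := congr1 (fun f : X -> Y => f u) e; rewrite /germ un.
by apply/funext => u; rewrite /germ; case: ifP => [/e//|_]; rewrite e // distxx.
Qed.

Definition is_germ (x : X) (e : X -> Y) : Prop :=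
  exists2 h, local_iso N x h & e = germ x h.

Definition germ_rep (x : X) (e : X -> Y) : X -> Y :=
  xget e [set h | local_iso N x h /\ e = germ x h].

Lemma germ_repP (x : X) (e : X -> Y) : is_germ x e ->
  local_iso N x (germ_rep x e) /\ germ x (germ_rep x e) = e.
Proof.
move=> [h hi eh]; rewrite /germ_rep.
by case: xgetP => [h' _ [hi' <-]|/(_ h)[]].
Qed.

(** Within distance [L] the result does not depend on the representative chosen, by
    [local_iso_unique]. *)
Definition germ_transport (x y : X) (e : X -> Y) : X -> Y := germ y (germ_rep x e).

Lemma germ_transport_isgerm (x y : X) (e : X -> Y) : dist x y <= L ->
  is_germ x e -> is_germ y (germ_transport x y e).
Proof.
move=> xy /germ_repP[hi _]; rewrite /germ_transport.
have hiS : local_iso S y (germ_rep x e) by apply: local_iso_recenter hi _; lia.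
have [h' [hi' hh']] := local_iso_grow hiS.
by exists h' => //; apply/germ_eq => u un; rewrite hh' //; lia.
Qed.

Lemma germ_local_system : local_system L is_germ germ_transport.
Proof.
split; first exact: germ_transport_isgerm.
  by move=> x e /germ_repP[].
move=> x y z e xy yz xz eg; have [hi _] := germ_repP eg.
have [hi' /germ_eq hh'] := germ_repP (germ_transport_isgerm xy eg).
(* The two representatives agree on the r0-ball at [y], hence on the s-ball there, which contains
   the r0-ball at [z]. *)
apply/germ_eq => u un; apply: (local_iso_unique (x := y)).
- by apply: local_iso_le hi'; lia.
- by apply: local_iso_recenter hi _; lia.
- exact: hh'.
- by have := dist_triangle z y u; lia.
Qed.

(** At a vertex [u] and its neighbours the glued map is the representative [h u], which gives the
    covering property. Near [x0] the germs of [f] obey the same transport rule as [sec], so they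
    agree with it by induction on the distance. *)
Lemma covering_of_section (x0 : X) (f : X -> Y) (sec : X -> X -> Y) :
    local_iso N x0 f -> sec x0 = germ x0 f -> (forall x, is_germ x (sec x)) ->
    (forall x y, adj x y -> germ_transport x y (sec x) = sec y) ->
  graph_covering (fun x => sec x x) /\ forall u, dist x0 u <= r -> sec u u = f u.
Proof.
move=> fi sec0 secg secT; pose h u := germ_rep u (sec u).
have hP u : local_iso N u (h u) /\ germ u (h u) = sec u by exact: germ_repP.
have sec_self u : sec u u = h u u by have [_ <-] := hP u; rewrite /germ distxx.
have sec_adj u v : adj u v -> sec v v = h u v.
  by move=> uv; rewrite -(secT _ _ uv) /germ_transport /germ distxx.
have N1 (u v : X) : adj u v -> dist u v <= N by move=> /dist_adj->; lia.
have N0 (u : X) : dist u u <= N by rewrite distxx.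
have hom u v : adj u v -> adj (sec u u) (sec v v).
  move=> uv; rewrite sec_self (sec_adj u) //.
  by have [[_ _ _ ad] _] := hP u; rewrite (ad u v (N0 u) (N1 _ _ uv)).
have lift u v : adj (sec u u) v -> exists2 w, adj u w & sec w w = v.
  rewrite sec_self => uv; have [[_ _ sur ad] _] := hP u.
  have [|w wN wv] := sur v; first by rewrite (dist_adj uv); lia.
  have uw : adj u w by rewrite -ad // wv.
  by exists w => //; rewrite (sec_adj u).
split; first split.
- apply: (@graph_ind _ _ (sec x0 x0)); first by exists x0.
  by move=> z v zv [u uz]; rewrite -uz in zv; have [w _ wv] := lift _ _ zv; exists w.
- exact: hom.
- move=> x; split=> [u /hom//|u v /set_mem xu /set_mem xv|v /lift[w]]; last by exists w.
  rewrite (sec_adj _ _ xu) (sec_adj _ _ xv); have [[inj _ _ _] _] := hP x.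
  by apply: inj; exact: N1.
- suff secE n u : dist x0 u = n -> n <= r -> sec u = germ u f.
    by move=> u ur; rewrite (secE _ u erefl ur) /germ distxx.
  elim: n u => [|n IH] u un nr; first by rewrite -(dist_eq0 un).
  have [v vu vn] := dist_step un; have secv := IH v vn (ltnW nr).
  have [hi hg] := hP v; rewrite secv in hg; move/germ_eq in hg.
  rewrite -(secT _ _ vu); apply/germ_eq => w wu.
  apply: (local_iso_unique (x := v)).
  + by apply: local_iso_le hi; lia.
  + by apply: local_iso_recenter fi _; lia.
  + exact: hg.
  + by have := dist_triangle u v w; rewrite (dist_adj vu); lia.
Qed.

End Germs.

Theorem theorem5 (K : realType) (X : graph)
    (X_lssc : large_scale_simply_connected K X) (X_cocompact : cocompact X) :
  USLG_rigid K X <-> (forall x : X, finite_set (Isom_stabilizer x)).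
Proof.
split=> [rig x|fin]; first exact: rigid_stabilizer_finite rig.
have [k X_sc] := X_lssc.
have [r0 Isom_det] := Isom_determined X_cocompact fin.
(* The germ calculus is used with [L] equal to [k.+1], the bound on the distance between vertices of
   [P_k(X)] whose stars meet. *)
have [S [sS Isom_ext]] := Isom_extend X_cocompact (r0 + k.+1).
have [N0 covN0] := cocompact_covering_local_iso S X_cocompact.
exists r0.+1%:R; first by rewrite ltr0n.
move=> r r0r; have r_ge0 : 0 <= r by apply: le_trans r0r; rewrite ler0n.
(* Distances are integers, so the r-ball is the q-ball. *)
pose q := Num.truncn r.
have ball_q (x u : X) : graph_ball x r u <-> (dist x u <= q)%N.
  by rewrite /graph_ball /= truncn_ge_nat.
have r0q : (r0 <= q)%N.
  by rewrite truncn_ge_nat //; apply: le_trans r0r; rewrite ler_nat.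
(* This dominates the radii for germ transport, for recentring [f] within the q-ball and for
   coverings; [R] is [N.+1] because a ball isometry loses one unit. *)
pose N := (S + k.+1 + q + N0).+1.
exists N.+1%:R.
  by apply: le_trans (ltW (truncnS_gt r)) _; rewrite ler_nat -/q /N; lia.
move=> Y Yloc x y f /ball_isometry_local_iso fi.
have Yloc' (z : Y) : exists x (g : X -> Y), local_iso N x g /\ g x = z.
  have [x' [g gi]] := Yloc z; exists x', g; split; last by case: gi.
  exact: ball_isometry_local_iso gi.
have covi (phi : X -> Y) : graph_covering phi -> forall z, local_iso S z phi.
  move=> phi_cov; apply: (covN0 Y _ phi phi_cov) => z.
  have [x' [g [gi gz]]] := Yloc' z; exists x', g; split=> //.
  by apply: local_iso_le gi; rewrite /N; lia.
have LS : local_system k.+1 (is_germ (X := X) (Y := Y) r0 N) (germ_transport r0 N).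
  by apply: (germ_local_system (s := r0 + k.+1) (S := S) (r := q)) => //; rewrite /N; lia.
have [|sec [sec0 secg secT]] := local_system_section X_sc (ltnSn k) LS
  (x := x) (e := germ r0 x f).
  by exists f.
have [cov covf] : graph_covering (fun u => sec u u) /\
    forall u, (dist x u <= q)%N -> sec u u = f u.
  by apply: (covering_of_section (r0 := r0) (s := r0 + k.+1) (S := S) (N := N)
    (L := k.+1)) fi sec0 secg secT => //; rewrite /N; lia.
exists (fun u => sec u u); split; first by split=> // u /ball_q; exact: covf.
move=> phi [phi_cov phif].
apply: (covering_unique (r0 := r0) (s := r0 + k.+1) (S := S) (L := k.+1) _ _ Isom_det Isom_ext sS
  (x := x)) => //.
- exact: covi.
- exact: covi.
- move=> u un; have uq := leq_trans un r0q.
  by rewrite covf // phif //; apply/ball_q.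
Qed.
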